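(* Let $L\colon TM\to\mathbb{R}$ be a Lagrangian satisfying conditions (S) and (G), let $p,q\in M$ and let $c\in\mathbb{R}$ be such that $\mathcal{J}^c\neq\emptyset$. If $\mathcal{N}_{p,q}$ is $c$-precompact then it is $c$-bounded.
   Context: $M$ is a smooth connected manifold of dimension $m+1$, $m\ge 1$, with a fixed auxiliary complete Riemannian metric $g$ and norm $\|v\|=\sqrt{g(v,v)}$. For a function $L$ on $TM$: $\partial_vL(x,v)[w]:=\frac{d}{ds}L(x,v+sw)|_{s=0}$; in natural coordinates $(x^i,v^i)$ of $TM$, $\partial_xL(x,v)[w]:=\sum_i\frac{\partial L}{\partial x^i}(x,v)w^i$; $\|\partial_vL(x,v)\|$, $\|\partial_xL(x,v)\|$ are the norms of these linear forms with respect to $g_x$. Since $\partial_xL$ depends on coordinates, bounds on $\|\partial_xL\|$ are read in local charts (the locally bounded function $C$ in the bound may depend on the chart). Condition (S): (i) $L\in C^1(TM)$; (ii) there is a $C^1$ vector field $K$ on $M$ such that $L$ is invariant under the local flow $\psi$ of $K$, i.e. $L(\psi(t,x),\partial_x\psi(t,x)[v])=L(x,v)$ whenever defined, and the Noether charge $N(x,v):=\partial_vL(x,v)[K_x]$ has the form $N(x,v)=Q_x(v)+d(x)$ with $Q$ a $C^1$ one-form and $d$ a $C^1$ function on $M$; (iii) $d$ is invariant by the flow of $K$ and $Q_x(K)<0$ for all $x\in M$. Put $L_c(x,v):=L(x,v)-\frac{Q_x(v)^2}{Q_x(K)}$. Condition (G): there are continuous functions $C,\lambda\colon M\to(0,+\infty)$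 such that, for all $x\in M$ and $v,v_1,v_2\in T_xM$: $L_c(x,v)\le C(x)(\|v\|^2+1)$; $\|\partial_xL_c(x,v)\|\le C(x)(\|v\|^2+1)$; $\|\partial_vL_c(x,v)\|\le C(x)(\|v\|+1)$; $(\partial_vL_c(x,v_2)-\partial_vL_c(x,v_1))[v_2-v_1]\ge\lambda(x)\|v_2-v_1\|^2$. Paths: $\Omega^{1,2}_{p,q}$ is the Hilbert manifold of absolutely continuous curves $z\colon[0,1]\to M$ with $\int_0^1 g(\dot z,\dot z)\,ds<+\infty$, $z(0)=p$, $z(1)=q$; $\mathcal{A}(z)=\int_0^1L(z,\dot z)\,ds$ for $z\in\Omega^{1,2}_{p,q}$; $\mathcal{N}_{p,q}:=\{z\in\Omega^{1,2}_{p,q}: N(z,\dot z)\text{ is constant a.e. on }[0,1]\}$; $\mathcal{J}:=\mathcal{A}|_{\mathcal{N}_{p,q}}$; $\mathcal{J}^c:=\{z\in\mathcal{N}_{p,q}:\mathcal{J}(z)\le c\}$. $\mathcal{N}_{p,q}$ is $c$-bounded if $\mathcal{J}^c\ne\emptyset$ and $\sup_{z\in\mathcal{J}^c}|N(z,\dot z)|<+\infty$ ($N(z,\dot z)$ being identified with its a.e. constant value). $\mathcal{N}_{p,q}$ is $c$-precompact if every sequence $(z_n)_n\subset\mathcal{J}^c$ has a uniformly convergent subsequence (uniform convergence on $[0,1]$ with respect to the distance of $g$, the limit being a continuous curve in $M$). *)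

(* Defs.v *)
From HB Require Import structures.
From mathcomp Require Import all_boot all_order all_algebra.
From mathcomp Require Import all_classical all_reals all_analysis.

Set Implicit Arguments.
Unset Strict Implicit.
Unset Printing Implicit Defensive.

Import Order.TTheory GRing.Theory Num.Theory.
Import numFieldNormedType.Exports.

Local Open Scope classical_set_scope.
Local Open Scope ring_scope.

(* f is of class C^k on the open set U.  Continuity of the derivatives is
   required direction by direction, which is the usual notion when V is finite
   dimensional (the only case in which Ck is used). *)
Fixpoint Ck (R : realType) (V W : normedModType R) (k : nat) (U : set V)
    (f : V -> W) : Prop :=
  match k with
  | 0 => forall x, U x -> {for x, continuous f}
  | k'.+1 => (forall x, U x -> differentiable f x) /\
             (forall v : V, Ck k' U (fun x => 'd f x v))
  end.

(* Manifolds of dimension m.+1.  [chart_map i] and [chart_inv i] are total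
   functions, meaningful only on [chart_dom i] and on its image.
   [chart_at x] is a chosen chart around x. *)
Record smoothManifold (R : realType) (m : nat) := SmoothManifold {
  carrier :> topologicalType;
  chart_index : Type;
  chart_dom : chart_index -> set carrier;
  chart_map : chart_index -> carrier -> 'rV[R]_m.+1;
  chart_inv : chart_index -> 'rV[R]_m.+1 -> carrier;
  chart_at : carrier -> chart_index;
  chart_atP : forall x, chart_dom (chart_at x) x;
  chart_dom_open : forall i, open (chart_dom i);
  chart_img_open : forall i, open (chart_map i @` chart_dom i);
  chart_mapK : forall i x, chart_dom i x -> chart_inv i (chart_map i x) = x;
  chart_map_continuous : forall i,
    {within chart_dom i, continuous (chart_map i)};
  chart_inv_continuous : forall i,
    {within chart_map i @` chart_dom i, continuous (chart_inv i)};
  chart_transition_smooth : forall i j k,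
    Ck k ((chart_map i @` chart_dom i) `&` (chart_inv i @^-1` chart_dom j))
         (chart_map j \o chart_inv i);
  manifold_hausdorff : hausdorff_space carrier;
  manifold_second_countable : @second_countable carrier
}.

Section TangentSpaces.
Context {R : realType} {m : nat} {M : smoothManifold R m}.
Implicit Types (i : chart_index M) (x : M).

Definition chart_img i : set 'rV[R]_m.+1 := chart_map i @` chart_dom i.

(* A tangent vector at x is represented by its components in the chosen chart
   [chart_at x]; its components in any other chart i around x are [tcoord i],
   obtained through the differential of the transition map.  The choice of
   [chart_at x] need not depend continuously on x: all regularity conditions
   below are expressed in the components relative to a fixed chart. *)
Definition tangent x : normedModType R := 'rV[R]_m.+1.

Definition tcoord i x (v : tangent x) : 'rV[R]_m.+1 :=
  'd (chart_map i \o chart_inv (chart_at x)) (chart_map (chart_at x) x) v.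

(* the tangent vector at x whose components in the chart i are w *)
Definition tvec i x (w : 'rV[R]_m.+1) : tangent x :=
  'd (chart_map (chart_at x) \o chart_inv i) (chart_map i x) w.

Definition velocity (z : R -> M) (s : R) : tangent (z s) :=
  derive1 (chart_map (chart_at (z s)) \o z) s.

Definition tangent_map (f : M -> M) x (v : tangent x) : tangent (f x) :=
  'd (chart_map (chart_at (f x)) \o f \o chart_inv (chart_at x))
     (chart_map (chart_at x) x) v.

Definition C1_function (f : M -> R) : Prop :=
  forall i, Ck 1 (chart_img i) (f \o chart_inv i : _ -> R^o).

Definition C1_vector_field (K : forall x, tangent x) : Prop :=
  forall i, Ck 1 (chart_img i)
    (fun y => tcoord i (K (chart_inv i y))).

Definition C1_one_form (Q : forall x, {scalar tangent x}) : Prop :=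
  forall i (w : 'rV[R]_m.+1), Ck 1 (chart_img i)
    (fun y => Q (chart_inv i y) (tvec i (chart_inv i y) w) : R^o).

(* F : TM -> R read in the natural coordinates (x^1, .., v^1, ..) of TM
   associated with the chart i *)
Definition local_rep i (F : forall x, tangent x -> R)
    (yw : 'rV[R]_m.+1 * 'rV[R]_m.+1) : R^o :=
  F (chart_inv i yw.1) (tvec i (chart_inv i yw.1) yw.2).

Definition C1_on_TM (F : forall x, tangent x -> R) : Prop :=
  forall i, Ck 1 (chart_img i `*` [set: 'rV[R]_m.+1]) (local_rep i F).

Definition partial_v (F : forall x, tangent x -> R) x (v w : tangent x) : R :=
  derive1 (fun s : R => F x (v + s *: w) : R^o) 0.

(* \sum_k (dF/dx^k)(x, v) w^k in the natural coordinates given by the chart i *)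
Definition partial_x i (F : forall x, tangent x -> R) x (v w : tangent x) : R :=
  \sum_(k < m.+1)
    'D_(delta_mx 0 k, 0) (local_rep i F) (chart_map i x, tcoord i v)
    * tcoord i w 0 k.

End TangentSpaces.

Section Flow.
Context {R : realType} {m : nat} {M : smoothManifold R m}.
Variable K : forall x : M, tangent x.

(* Continuity of z is needed separately, since a chart is unconstrained outside
   its domain. *)
Definition integral_curve (a b : R) (z : R -> M) : Prop :=
  forall s, a < s < b ->
    [/\ {for s, continuous z},
        derivable (chart_map (chart_at (z s)) \o z) s 1 &
        velocity z s = K (z s)].

Definition flow_value (t : R) (x y : M) : Prop :=
  exists (a b : R) (z : R -> M),
    [/\ a < 0 < b, a < t < b, integral_curve a b z, z 0 = x & z t = y].

Definition flow_defined (t : R) (x : M) : Prop := exists y, flow_value t x y.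

(* The maximal local flow of K; for K of class C^1 the value is unique. *)
Definition flow (t : R) (x : M) : M := xget x [set y | flow_value t x y].

End Flow.

Record riemannian_metric (R : realType) (m : nat) (M : smoothManifold R m) :=
  RiemannianMetric {
  metric_form :> forall x : M, tangent x -> {scalar tangent x};
  metric_form_sym : forall x (v w : tangent x), metric_form v w = metric_form w v;
  metric_form_pos : forall x (v : tangent x), v != 0 -> 0 < metric_form v v;
  metric_form_smooth : forall (i : chart_index M) (u w : 'rV[R]_m.+1) k,
    Ck k (chart_img i)
      (fun y => metric_form (tvec i (chart_inv i y) u)
                            (tvec i (chart_inv i y) w) : R^o)
}.

Section Distance.
Context {R : realType} {m : nat} {M : smoothManifold R m}.
Variable g : riemannian_metric M.

Definition tnorm (x : M) (v : tangent x) : R := Num.sqrt (g x v v).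

Definition covector_norm (x : M) (l : tangent x -> R) : \bar R :=
  ereal_sup [set (`|l w|)%:E | w in [set w : tangent x | tnorm w <= 1]].

Definition C1_curve (J : set R) (z : R -> M) : Prop :=
  [/\ open J, (forall s, J s -> {for s, continuous z}) &
    forall i : chart_index M,
      @Ck R R^o 'rV[R]_m.+1 1 (J `&` z @^-1` chart_dom i) (chart_map i \o z)].

Definition piecewise_C1 (z : R -> M) : Prop :=
  {within `[0, 1], continuous z} /\
  exists (n : nat) (t : nat -> R),
    [/\ t 0%N = 0, t n = 1 &
      forall k, (k < n)%N -> t k < t k.+1 /\
        exists (J : set R) (zk : R -> M),
          [/\ C1_curve J zk, `[t k, t k.+1] `<=` J &
            {in `[t k, t k.+1], forall s, z s = zk s}]].

Definition curve_length (z : R -> M) : \bar R :=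
  (\int[lebesgue_measure]_(s in `[0%R, 1%R]) (tnorm (velocity z s))%:E)%E.

Definition riemannian_dist (x y : M) : \bar R :=
  ereal_inf [set curve_length z | z in
    [set z | [/\ piecewise_C1 z, z 0 = x & z 1 = y]]].

Definition complete_metric : Prop :=
  forall u : nat -> M,
    (forall e : R, 0 < e -> exists N, forall n k, (N <= n)%N -> (N <= k)%N ->
      (riemannian_dist (u n) (u k) < e%:E)%E) ->
    exists x, forall e : R, 0 < e -> exists N, forall n, (N <= n)%N ->
      (riemannian_dist (u n) x < e%:E)%E.

End Distance.

Definition abs_continuous (R : realType) (V : normedModType R) (a b : R)
    (f : R -> V) : Prop :=
  forall e : R, 0 < e -> exists2 d : R, 0 < d &
    forall (n : nat) (l r : 'I_n -> R),
      (forall k, [/\ a <= l k, l k <= r k & r k <= b]) ->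
      trivIset setT (fun k => [set` `]l k, r k[]) ->
      \sum_(k < n) (r k - l k) < d ->
      \sum_(k < n) `|f (r k) - f (l k)| < e.

Section Lagrangian.
Context {R : realType} {m : nat} {M : smoothManifold R m}.
Variable g : riemannian_metric M.

Variable L : forall x : M, tangent x -> R.
Variable K : forall x : M, tangent x.
Variable Q : forall x : M, {scalar tangent x}.
Variable d : M -> R.

Definition noether (x : M) (v : tangent x) : R := partial_v L v (K x).

Definition condition_S : Prop :=
  [/\ C1_on_TM L,
      C1_vector_field K,
      (forall (t : R) (x : M) (v : tangent x), flow_defined K t x ->
         L (tangent_map (flow K t) v) = L v),
      [/\ C1_one_form Q, C1_function d &
          forall (x : M) (v : tangent x), noether v = Q x v + d x] &
      (forall (t : R) (x : M), flow_defined K t x -> d (flow K t x) = d x) /\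
      (forall x : M, Q x (K x) < 0)].

Definition Lc (x : M) (v : tangent x) : R := L v - Q x v ^+ 2 / Q x (K x).

(* The bound on the x-derivative depends on coordinates: its bounding function
   is allowed to depend on the chart. *)
Definition condition_G : Prop :=
  exists C lambda : M -> R,
    [/\ continuous C, continuous lambda &
        forall x, 0 < C x /\ 0 < lambda x] /\
    [/\ (forall (x : M) (v : tangent x), Lc v <= C x * (tnorm g v ^+ 2 + 1)),
        (forall i : chart_index M, exists Ci : M -> R,
           [/\ {within chart_dom i, continuous Ci},
               forall x, chart_dom i x -> 0 < Ci x &
               forall x (v : tangent x), chart_dom i x ->
                 (covector_norm g (partial_x i Lc v)
                    <= (Ci x * (tnorm g v ^+ 2 + 1))%:E)%E]),
        (forall (x : M) (v : tangent x),
           (covector_norm g (partial_v Lc v)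
              <= (C x * (tnorm g v + 1))%:E)%E) &
        (forall (x : M) (v1 v2 : tangent x),
           lambda x * tnorm g (v2 - v1) ^+ 2
             <= partial_v Lc v2 (v2 - v1) - partial_v Lc v1 (v2 - v1))].

(* Curves on [0, 1] are total functions R -> M of which only the values on
   [0, 1] matter. *)
Definition AC_curve (z : R -> M) : Prop :=
  {within `[0, 1], continuous z} /\
  forall (i : chart_index M) (a b : R), 0 <= a -> a <= b -> b <= 1 ->
    (forall s, a <= s <= b -> chart_dom i (z s)) ->
    abs_continuous a b (chart_map i \o z).

Definition Omega12 (p q : M) : set (R -> M) := [set z |
  [/\ AC_curve z, z 0 = p, z 1 = q &
    (\int[lebesgue_measure]_(s in `[0%R, 1%R])
       (g (z s) (velocity z s) (velocity z s))%:E < +oo)%E]].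

Definition action (z : R -> M) : \bar R :=
  (\int[lebesgue_measure]_(s in `[0%R, 1%R]) (L (velocity z s))%:E)%E.

Definition noether_const (z : R -> M) (k : R) : Prop :=
  {ae (@lebesgue_measure R), forall s, 0 <= s <= 1 -> noether (velocity z s) = k}.

Definition Npq (p q : M) : set (R -> M) :=
  [set z | Omega12 p q z /\ exists k, noether_const z k].

Definition Jsub (p q : M) (c : R) : set (R -> M) :=
  [set z | Npq p q z /\ (action z <= c%:E)%E].

Definition c_bounded (p q : M) (c : R) : Prop :=
  Jsub p q c !=set0 /\
  (ereal_sup [set (`|k|)%:E | k in
     [set k | exists2 z, Jsub p q c z & noether_const z k]] < +oo)%E.

Definition c_precompact (p q : M) (c : R) : Prop :=
  forall u : nat -> (R -> M), (forall n, Jsub p q c (u n)) ->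
    exists (sigma : nat -> nat) (z : R -> M),
      [/\ {homo sigma : n k / (n < k)%N},
          {within `[0, 1], continuous z} &
          forall e : R, 0 < e -> exists N, forall n, (N <= n)%N ->
            forall s, 0 <= s <= 1 -> (riemannian_dist g (u (sigma n) s) (z s) < e%:E)%E].

End Lagrangian.

(* Main.v *)
(* Along the fibre direction K_x the Lagrangian is quadratic, since its derivative there
   is the affine function N = Q + d.  Splitting v = w + t K_x with Q_x(w) = 0 turns L(x,v)
   into L_c(x,w) + t d(x) + t^2 Q_x(K_x) / 2, where L_c(x,.) is strongly convex and
   N(x,v) = d(x) + t Q_x(K_x).  Hence near any point x0 one can choose a linear form l in a
   chart (a large multiple of Q at x0) and a constant C such that
     L(x,v) >= N(x,v)^2 + N(x,v) l(v) - C        for all x near x0 and all v.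
   On a curve with N = k this lower bound is k^2 + k (l o z)' - C, and integrating (l o z)'
   only sees the endpoints.  Along the curves uniformly close to a fixed continuous curve,
   finitely many charts therefore give action >= k^2 - B (|k| + 1) with B independent of
   the curve, so that k is bounded when the action is.
   Absolutely continuous functions satisfy the fundamental theorem of calculus because
   their variation is the cumulative function of a measure with a Lebesgue density. *)
From HB Require Import structures.
Require Import Defs.
From mathcomp Require Import all_boot all_order all_algebra.
From mathcomp Require Import all_classical all_reals all_analysis.
From mathcomp Require Import measurable_realfun ring lra.

Set Implicit Arguments.
Unset Strict Implicit.
Unset Printing Implicit Defensive.

Import Order.TTheory GRing.Theory Num.Theory.
Import numFieldNormedType.Exports.

Local Open Scope classical_set_scope.
Local Open Scope ring_scope.

(** * Absolutely continuous functions *)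

Section AbsoluteContinuity.
Context {R : realType}.
Implicit Types (a b : R) (h : R -> R) (s t : seq (R * R)).

(** Why $l$ is a large multiple of $Q_{x_0}$: write $B=-Q_x(K_x)>0$ and $v=w+tK_x$. Along $K_x$ the
    Lagrangian is concave, and subtracting $N^2$ makes this worse, by $-B^2t^2$. Subtracting
    $N\,l(v)$ brings in $+B\,l(K_x)\,t^2$, so $l(K_x)\ge B+1$ leaves at least $Bt^2/2$. The price is
    the cross term $Bt\,l(w)$. A form proportional to $Q_{x_0}$ is small on $\ker Q_x$ for $x$ near
    $x_0$, so the strong convexity of $L_c$ absorbs this term. The form must have constant
    coefficients in a chart, since only then does its integral along a curve reduce to the
    endpoints; $Q_x$ itself need not be closed. Two obstacles shape the rest. Closeness of curves is
    measured by the Riemannian distance, while the local bound lives in charts, so a small distance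
    must be shown to force a point into a given neighbourhood. And $L$ along a curve is controlled
    only almost everywhere, without measurability, so integrals are compared through integrable
    minorants. *)

Definition nonoverlapping s : bool :=
  all (fun u => u.1 <= u.2) s &&
  pairwise (fun u v => (u.2 <= v.1) || (v.2 <= u.1)) s.

Definition total_length s : R := \sum_(u <- s) (u.2 - u.1).

(** Absolute continuity on the whole line, with lists in place of indexed families: lists can be
    refined by concatenation. Functions on $[a,b]$ are brought to this form by composing with
    [clamp], which is monotone and 1-Lipschitz. *)
Definition abs_cont h : Prop := forall e, 0 < e -> exists2 d, 0 < d &
  forall s, nonoverlapping s -> total_length s < d ->
    \sum_(u <- s) `|h u.2 - h u.1| < e.

Definition clamp a b (x : R) : R := Num.max a (Num.min b x).

Lemma clamp_bounds a b x : a <= b -> a <= clamp a b x <= b.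
Proof. by move=> ab; rewrite /clamp le_max lexx ge_max ab ge_min lexx. Qed.

Lemma clamp_id a b x : a <= x <= b -> clamp a b x = x.
Proof. by move=> /andP[ax xb]; rewrite /clamp min_r// max_r. Qed.

Lemma clamp_mono a b x y : x <= y -> clamp a b x <= clamp a b y.
Proof.
move=> xy; rewrite /clamp; by case: (leP b x) => ?; case: (leP b y) => ?; case: (leP a b) => ?; case: (leP a x) => ?; case: (leP a y) => ?; lra.
Qed.

Lemma clamp_lip a b x y : a <= b -> x <= y -> clamp a b y - clamp a b x <= y - x.
Proof.
move=> ab xy; rewrite /clamp.
by case: (leP b x) => ?; case: (leP b y) => ?; case: (leP a b) => ?; case: (leP a x) => ?; case: (leP a y) => ?; lra.
Qed.

Lemma abs_cont_clamp a b h : a <= b -> @abs_continuous R R^o a b h ->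
  abs_cont (h \o clamp a b).
Proof.
move=> ab H e e0; have [d d0 Hd] := H _ e0; exists d => // s /andP[/allP s12 sp] sd.
pose u k := tnth (in_tuple s) k.
have := Hd (size s) (fun k => clamp a b (u k).1) (fun k => clamp a b (u k).2).
rewrite (big_tnth _ _ s) /=; apply.
- move=> k; have /andP[? _] := clamp_bounds (u k).1 ab.
  have /andP[_ ?] := clamp_bounds (u k).2 ab; split => //.
  by apply: clamp_mono; apply: s12; exact: mem_tnth.
- apply/trivIsetP => i j _ _.
  wlog ij : i j / (i < j)%N.
    move=> wl; rewrite neq_ltn => /orP[] ij; first by apply: wl => //; rewrite neq_ltn ij.
    by rewrite setIC; apply: wl => //; rewrite neq_ltn ij.
  move=> _; apply/seteqP; split => // x /=.
  rewrite !in_itv/= => -[/andP[x1 x2] /andP[x3 x4]].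
  have := pairwiseP (0, 0) sp i j (ltn_ord i) (ltn_ord j) ij.
  have uE (k : 'I_(size s)) : nth (0, 0) s k = u k by rewrite /u (tnth_nth (0,0)).
  by rewrite !uE => /orP[] /(clamp_mono a b) Q; lra.
- rewrite (le_lt_trans _ sd)// /total_length (big_tnth _ _ s); apply: ler_sum => k _.
  by apply: clamp_lip => //; apply: s12; exact: mem_tnth.
Qed.

Lemma partition_family a b (p : seq R) h : itv_partition a b p ->
  exists s, [/\ nonoverlapping s, total_length s = b - a,
    variation a b h p = \sum_(u <- s) `|h u.2 - h u.1| &
    forall u, u \in s -> a <= u.1 /\ u.2 <= b].
Proof.
move=> [ap /eqP lb].
exists (zip (belast a p) p).
have vE : variation a b h p = \sum_(u <- zip (belast a p) p) `|h u.2 - h u.1|.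
  rewrite /variation /=.
  rewrite [RHS](big_nth (0,0)) size_zip size_belast minnn.
  rewrite !big_mkord; apply: eq_bigr => -[i /= ip] _.
  rewrite nth_zip ?size_belast//=.
  congr (`|h _ - h _|); first exact: set_nth_default.
  by rewrite [RHS](set_nth_default b) ?size_belast// lastI nth_rcons size_belast ip.
have inP u : u \in zip (belast a p) p -> [/\ a <= u.1, u.1 <= u.2 & u.2 <= b].
  elim: p a ap lb {vE} => [|x p IH] a//= /andP[ax xp] lb.
  have xb : x <= b.
    rewrite -lb; have := mem_last x p; rewrite inE => /predU1P[->//|].
    by have /allP xlt := order_path_min lt_trans xp; move=> /xlt/ltW.
  rewrite inE => /predU1P[->/=|/(IH _ xp lb)[u1 u12 u2]]; first by split=> //; exact: ltW.
  by split => //; apply: le_trans u1; exact: ltW.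
split => //.
- apply/andP; split; first by apply/allP => u /inP[].
  elim: p a ap lb {vE inP} => [|x p IH] a//= /andP[ax xp] lb.
  rewrite (IH x)// andbT; apply/allP => u.
  have : {in zip (belast x p) p, forall u, x <= u.1}.
    elim: p x xp {IH ax lb} => [|y p IH] x //= /andP[xy yp] v; rewrite inE => /predU1P[->//|].
    by move/(IH _ yp); apply: le_trans; exact: ltW.
  by move=> /[apply] ->.
- elim: p a ap lb {vE inP} => [|x p IH] a/=.
    by move=> _ <-; rewrite /total_length big_nil subrr.
  move=> /andP[ax xp] lb; rewrite /total_length big_cons/=.
  by have := IH x xp lb; rewrite /total_length => ->; lra.
- by move=> u /inP[].
Qed.

Lemma nonoverlapping_refine (u : R * R) s t :
  nonoverlapping (u :: t) -> nonoverlapping s ->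
  (forall v, v \in s -> u.1 <= v.1 /\ v.2 <= u.2) -> nonoverlapping (s ++ t).
Proof.
move=> /andP[/= /andP[u12 t12] /andP[ut tp]] /andP[s12 sp] su.
rewrite /nonoverlapping all_cat s12 t12 /= pairwise_cat sp tp !andbT.
apply/allrelP => v w vs wt; have [uv vu] := su _ vs.
by move/allP: ut => /(_ w wt)/orP[] uw; apply/orP; [left|right]; lra.
Qed.


Lemma nonoverlapping_catC s t : nonoverlapping (s ++ t) = nonoverlapping (t ++ s).
Proof.
rewrite /nonoverlapping !all_cat !pairwise_cat allrelC.
rewrite [all _ s && _]andbC; congr (_ && _); rewrite [X in _ && X]andbC.
congr (_ && _); apply: eq_allrel => u v /=; exact: orbC.
Qed.

(** Replacing an interval by a partition of it keeps the family nonoverlapping and its total length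
    unchanged. The induction on [s] moves a partition of the head interval into [t] and takes the
    supremum over partitions last. *)
Lemma family_total_variation_le h (e d : R) :
  (forall s, nonoverlapping s -> total_length s < d ->
    \sum_(u <- s) `|h u.2 - h u.1| <= e) ->
  forall s t, nonoverlapping (s ++ t) -> total_length (s ++ t) < d ->
    (\sum_(u <- s) total_variation u.1 u.2 h
      + (\sum_(u <- t) `|h u.2 - h u.1|)%:E <= e%:E)%E.
Proof.
move=> H; elim=> [|u s IH] t; first by move=> ? ?; rewrite big_nil add0e lee_fin; exact: H.
move=> not_ lt_.
have := not_; rewrite /= => /andP[/= /andP[u12 st12] _].
have TV0 : (0 <= \sum_(u <- s) total_variation u.1 u.2 h)%E.
  rewrite big_seq; apply: sume_ge0 => v vs; apply: total_variation_ge0.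
  by move: st12; rewrite all_cat => /andP[/allP st12 _]; exact: st12.
(* A degenerate interval has variation zero and is dropped; the others have the trivial
   partition. *)
move: u12; rewrite le_eqVlt => /orP[/eqP u12|u12].
  rewrite big_cons -u12 total_variationxx add0e; apply: IH.
    by case/andP : not_ => /= /andP[_ ?] /andP[_ ?]; rewrite /nonoverlapping; apply/andP.
  by move: lt_; rewrite /total_length big_cons u12 subrr add0r.

have refine_u p : itv_partition u.1 u.2 p ->
    (\sum_(u <- s) total_variation u.1 u.2 h
      + (\sum_(v <- t) `|h v.2 - h v.1| + variation u.1 u.2 h p)%:E <= e%:E)%E.
  move=> /(partition_family h)[q [nq lq -> qu]].
  rewrite -big_cat; apply: IH.
    by rewrite catA nonoverlapping_catC; exact: nonoverlapping_refine not_ nq qu.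
  move: lt_; rewrite /total_length big_cons !big_cat /= -/(total_length q) lq.
  by move=> lt_; apply: le_lt_trans lt_; lra.
(* Moving the sum to the other side in the extended reals requires it to be finite; the trivial
   partition of [u] already bounds it. *)
have fin : (\sum_(u <- s) total_variation u.1 u.2 h \is a fin_num).
  have := refine_u _ (itv_partition1 u12).
  rewrite ge0_fin_numE//; case: (\sum_(u <- s) _)%E TV0 => //= r _ _; exact: ltry.
rewrite big_cons -addeA -leeBrDr; last by rewrite fin_numD fin.
apply: ge_ereal_sup => _ [_ [p up <-] <-]; rewrite leeBrDr; last by rewrite fin_numD fin.
by rewrite addeCA -EFinD [X in X%:E]addrC; exact: refine_u up.
Qed.

(** With $d$ associated with $e=1$, the variation is at most $1$ on every interval shorter than $d$,
    and $[a,b]$ is covered by finitely many steps of length $d/2$. *)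
Lemma abs_cont_bounded_variation h a b : abs_cont h -> a <= b ->
  total_variation a b h \is a fin_num.
Proof.
move=> /(_ 1 ltr01)[d d0 Hd] ab.
have small x y : x <= y -> y - x < d -> (total_variation x y h <= 1)%E.
  move=> xy yxd; have := @family_total_variation_le h 1 d _ [:: (x, y)] [::].
  rewrite cats0 /total_length !big_seq1 big_nil adde0 /=; apply => //.
    by move=> s ns ls; apply/ltW/Hd.
  by rewrite /nonoverlapping /= xy.
have TVn (n : nat) x y : x <= y -> y - x <= n%:R * (d / 2) ->
    (total_variation x y h <= n%:R%:E)%E.
  elim: n x y => [|n IH] x y xy.
    rewrite mul0r => yx; have -> : y = x by lra.
    by rewrite total_variationxx.
  move=> yx; pose z := Num.min y (x + d / 2).
  have zE : z = Num.min y (x + d/2) by [].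
  have xz : x <= z by rewrite le_min xy lerDl divr_ge0// ltW.
  have zy : z <= y by rewrite ge_min lexx.
  rewrite (total_variationD _ xz zy) -natr1 EFinD addeC leeD//.
    have nd : 0 <= n%:R * (d / 2) by rewrite mulr_ge0// divr_ge0// ltW.
    apply: IH => //; move: yx; rewrite -natr1 mulrDl mul1r zE.
    by case: (leP y (x + d/2)) => ? ?; lra.
  by apply: small => //; rewrite zE; case: (leP y (x + d/2)) => ?; lra.
pose n := Num.bound ((b - a) / (d / 2)).
have : (total_variation a b h <= n%:R%:E)%E.
  apply: TVn => //; rewrite -ler_pdivrMr; last by rewrite divr_gt0.
  by apply/ltW/archi_boundP; rewrite !divr_ge0// ?subr_ge0// ltW.
move=> /le_lt_trans/(_ (ltry _)); rewrite ge0_fin_numE//; exact: total_variation_ge0.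
Qed.

End AbsoluteContinuity.

(** * Densities of nondecreasing absolutely continuous functions *)

Section NondecreasingDensity.
Context {R : realType}.
Implicit Types (a b : R) (F h : R -> R).
Local Notation mu := (@lebesgue_measure R).


Lemma abs_cont_continuous h : abs_cont h -> continuous h.
Proof.
move=> H x; apply/(@cvgrPdist_lt _ R^o) => e e0.
have [d d0 Hd] := H _ e0.
have key u v : u <= v -> `|u - v| < d -> `|h u - h v| < e.
  move=> uv uvd; have := Hd [:: (u, v)].
  rewrite /total_length !big_seq1 /= distrC; apply; first by rewrite /nonoverlapping /= uv.
  by rewrite (le_lt_trans _ uvd)// distrC ler_norm.
have xd := @cvgr_dist_lt _ R^o R (nbhs x) _ id x (@cvg_id _ _) d d0.
near=> y; have xyd : `|x - y| < d by near: y; exact: xd.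
have [xy|/ltW yx] := leP x y; first exact: key.
by rewrite distrC; apply: key => //; rewrite distrC.
Unshelve. all: by end_near. Qed.

Lemma open_interval_endpoints (I : set R) A B : open I -> is_interval I ->
  I !=set0 -> I `<=` `]A, B[ ->
  [/\ I = `]inf I, sup I[%classic, inf I < sup I, A <= inf I & sup I <= B].
Proof.
move=> oI iI I0 IAB.
have lI : has_lbound I by exists A => x /IAB /=; rewrite in_itv/= => /andP[/ltW].
have uI : has_ubound I by exists B => x /IAB /=; rewrite in_itv/= => /andP[_ /ltW].
have IE : I = `]inf I, sup I[%classic.
  rewrite -[LHS](iffLR (interior_id I) oI) (interval_bounded_interior iI lI uI).
  by apply/seteqP; split => x /=; rewrite in_itv.
split => //.
- by case: I0 => x; rewrite {1}IE/= in_itv/= => /andP[]; exact: lt_trans.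
- by apply: lb_le_inf => // x /IAB /=; rewrite in_itv/= => /andP[/ltW].
- by apply: ge_sup => // x /IAB /=; rewrite in_itv/= => /andP[_ /ltW].
Qed.

Lemma disjoint_oo_itv (l1 r1 l2 r2 : R) : l1 < r1 -> l2 < r2 ->
  [set` `]l1, r1[] `&` [set` `]l2, r2[] = set0 -> (r1 <= l2) || (r2 <= l1).
Proof.
move=> h1 h2 h; apply: contrapT => /negP; rewrite negb_or -!ltNge => /andP[h3 h4].
pose m := (Num.max l1 l2 + Num.min r1 r2) / 2.
suff : (set0 : set R) m by [].
rewrite -h /m; split; rewrite /= in_itv/=.
- by case: (leP l1 l2) => ?; case: (leP r1 r2) => ?; apply/andP; split; lra.
- by case: (leP l1 l2) => ?; case: (leP r1 r2) => ?; apply/andP; split; lra.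
Qed.

Section Stieltjes.
Variable F : cumulative R R.
Local Notation nu := (lebesgue_stieltjes_measure F).

Lemma lebesgue_stieltjes_measure_ocitv x y : x <= y -> nu `]x, y] = (F y - F x)%:E.
Proof.
move=> xy; rewrite /lebesgue_stieltjes_measure /measure_extension.
by rewrite measurable_mu_extE/= ?wlength_itv_bnd//; exact: is_ocitv.
Qed.

(** $V$ is a countable disjoint union of open intervals, and any finitely many of them form a
    nonoverlapping family of total length at most $\mu(V)<d$. Boundedness of $V$ makes their
    endpoints real. *)
Lemma lebesgue_stieltjes_measure_open_le (V : set R) A B e d : open V ->
  V `<=` `]A, B[ -> (mu V < d%:E)%E ->
  (forall s, nonoverlapping s -> total_length s < d ->
    \sum_(u <- s) `|F u.2 - F u.1| < e) -> (nu V <= e%:E)%E.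
Proof.
move=> oV VAB muV He; pose I := open_disjoint_itv oV.
have VI : V = \bigcup_q I q := open_disjoint_itv_bigcup oV.
have mI q : measurable (I q : set (measurableTypeR R)).
  by apply: open_measurable; exact: open_disjoint_itv_open.
have tI : trivIset setT I := @open_disjoint_itv_trivIset _ _ oV.
have IE q : I q !=set0 ->
    [/\ I q = `]inf (I q), sup (I q)[%classic, inf (I q) < sup (I q), A <= inf (I q) & sup (I q) <= B].
  move=> I0; apply: open_interval_endpoints => //.
  - exact: open_disjoint_itv_open.
  - exact: open_disjoint_itv_is_interval.
  - by apply: subset_trans VAB; rewrite VI; exact: bigcup_sup.
have sumE (m : {measure set (measurableTypeR R) -> \bar R}) : m V = (\sum_(0 <= q <oo) m (I q))%E.
  rewrite VI measure_bigcup//; apply: eq_eseriesl => q; exact: in_setT.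
have nE : nu V = (\sum_(0 <= q <oo) nu (I q))%E := sumE nu.
rewrite nE; apply: lime_le; first by apply: is_cvg_nneseries.
apply: nearW => k.
(* The enumeration may contain empty sets, whose [inf] and [sup] are meaningless as endpoints. *)
pose J := [seq q <- iota 0 k | I q != set0].
pose s := [seq (inf (I q), sup (I q)) | q <- J].
have JI q : q \in J -> I q !=set0 by rewrite mem_filter => /andP[/set0P].
have sub_sum (f : nat -> \bar R) : (forall q, I q = set0 -> f q = 0%E) ->
    (\sum_(0 <= q < k) f q = \sum_(q <- J) f q)%E.
  move=> f0; rewrite /J big_filter [RHS]big_mkcond /index_iota subn0.
  by apply: eq_bigr => q _; case: ifPn => // /negPn/eqP/f0.
have ns : nonoverlapping s.
  apply/andP; split; first by apply/allP => _ /mapP[q /JI /IE[_ /ltW ? _ _] ->].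
  rewrite pairwise_map; have : pairwise ltn J.
    by apply: pairwise_filter; rewrite -(sorted_pairwise ltn_trans); exact: iota_ltn_sorted.

  apply: (@sub_in_pairwise _ [pred q | I q != set0]); last exact: filter_all.
  move=> i j /set0P/IE[Ii i12 _ _] /set0P/IE[Ij j12 _ _] ij /=.
  apply: disjoint_oo_itv => //; rewrite -Ii -Ij.
  by move/trivIsetP : tI => /(_ i j Logic.I Logic.I); apply; rewrite neq_ltn (ij : (i < j)%N).
have lenE : (total_length s)%:E = (\sum_(0 <= q < k) mu (I q))%E.
  rewrite sub_sum; last by move=> q ->; exact: measure0.
  rewrite /total_length /s big_map -sumEFin big_seq [RHS]big_seq.
  apply: eq_bigr => q /JI/IE[Iq lt_ _ _] /=; rewrite [in RHS]Iq.
  by rewrite lebesgue_measure_itv/= lte_fin lt_ -EFinD.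
have ls : total_length s < d.
  rewrite -lte_fin lenE; apply: le_lt_trans muV.
  rewrite (sumE mu); exact: nneseries_lim_ge.
apply: (@le_trans _ _ (\sum_(u <- s) `|F u.2 - F u.1|)%:E); last first.
  by rewrite lee_fin ltW// He.
rewrite sub_sum; last by move=> q ->; exact: measure0.
rewrite /s big_map -sumEFin big_seq [leRHS]big_seq.
apply: lee_sum => q /JI/IE[Iq lt_ _ _] /=.
apply: (@le_trans _ _ (nu `]inf (I q), sup (I q)])).
  apply: le_measure; rewrite ?inE; [exact: mI|exact: measurable_itv|].
  by rewrite [X in X `<=` _]Iq; exact: subset_itv_oo_oc.
by rewrite lebesgue_stieltjes_measure_ocitv ?(ltW lt_)// lee_fin ler_norm.
Qed.

Lemma lebesgue_stieltjes_measure_dominated a b (A : set (measurableTypeR R)) :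
  abs_cont F -> measurable A -> A `<=` `]a, b] -> mu A = 0%E -> nu A = 0%E.
Proof.
move=> acF mA Aab muA; apply/eqP; rewrite eq_le measure_ge0 andbT.
apply/lee_addgt0Pr => e e0; rewrite add0e; have [d d0 Hd] := acF _ e0.
have [|U [oU AU UA]] := lebesgue_regularity_outer mA _ d0.
  by rewrite [ltLHS]muA ltry.
(* Outer regularity may give an unbounded open set; cutting it keeps [A] inside and makes its
   components bounded. *)
pose V := U `&` `]a - 1, b + 1[.
have oV : open V by apply: openI => //; exact: interval_open.
have mU : measurable (U : set (measurableTypeR R)) by exact: open_measurable.
have mV : measurable (V : set (measurableTypeR R)) by exact: open_measurable.
apply: (@le_trans _ _ (nu V)).
  apply: le_measure; rewrite ?inE// => x Ax; split; first exact: AU.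
  by have := Aab _ Ax; rewrite /= !in_itv/= => /andP[? ?]; apply/andP; split; lra.
apply: (@lebesgue_stieltjes_measure_open_le V (a - 1) (b + 1) e d) => //.
  by move=> x [].
apply: le_lt_trans UA; apply: (@le_trans _ _ (mu U)).
  by apply: le_measure; rewrite ?inE// => x [].
have -> : mu U = (mu A + mu (U `\` A))%E.
  rewrite -{1}(setDUK AU) measureU//; first exact: measurableD.
  by rewrite setDIK.
by rewrite muA add0e.
Qed.

End Stieltjes.

(** The density is the Radon-Nikodym derivative of the Stieltjes measure of $F$. Restricting that
    measure to $]a,b]$ makes it finite, and absolute continuity of $F$ makes it vanish on Lebesgue
    null sets. *)
Lemma nondecreasing_abs_cont_density F a b : {homo F : x y / x <= y} ->
  abs_cont F -> exists2 f : R -> R, mu.-integrable setT (EFin \o f) &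
    forall x, a <= x <= b -> (F x - F a)%:E = (\int[mu]_(t in `]a, x]) (f t)%:E)%E.
Proof.
move=> ndF acF.
have rcF : right_continuous F by apply/right_continuousW/abs_cont_continuous.
pose Fc : cumulative R R := HB.pack F (isCumulative.Build R _ R F ndF rcF).
pose nu := lebesgue_stieltjes_measure Fc.
have mab : measurable (`]a, b] : set (measurableTypeR R)) by exact: measurable_itv.
have fin : (nu `]a, b]%classic < +oo)%E.
  have [ab|ba] := leP a b; first by rewrite /nu lebesgue_stieltjes_measure_ocitv// ltry.
  rewrite set_itv_ge; first by have -> : nu set0 = 0%E; [exact: measure0|exact: ltry].
  by rewrite -leNgt bnd_simp ltW.
have dom : mfrestr mab fin `<< mu.
  apply/null_content_dominatesP => A mA muA; rewrite /mfrestr/= /mrestr.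
  apply: (@lebesgue_stieltjes_measure_dominated Fc a b) => //.
  - exact: measurableI.
  - apply/eqP; rewrite eq_le measure_ge0 andbT -[leRHS]muA.
    by apply: le_measure; rewrite ?inE//; exact: measurableI.
have [f [f0 ffin fi fE]] := radon_nikodym_sigma_finite dom.
have fineK' : EFin \o (fine \o f) = f by apply/funext => x /=; rewrite fineK.
exists (fine \o f); first by rewrite fineK'.
move=> x /andP[ax xb].
transitivity (\int[mu]_(t in `]a, x]) f t)%E; last first.
  by apply: eq_integral => t _; rewrite fineK.
rewrite -fE; last exact: measurable_itv.
transitivity (nu (`]a, x]%classic `&` `]a, b]%classic)); last by [].
rewrite setIidl; last by apply: subset_itvl; rewrite bnd_simp.
by rewrite /nu lebesgue_stieltjes_measure_ocitv.
Qed.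

End NondecreasingDensity.

(** * The fundamental theorem of calculus for absolutely continuous functions *)

Section FundamentalTheorem.
Context {R : realType}.
Implicit Types (a b : R) (h : R -> R).
Local Notation mu := (@lebesgue_measure R).

Lemma nonoverlapping_clamp a b s : a <= b -> nonoverlapping s ->
  nonoverlapping [seq (clamp a b u.1, clamp a b u.2) | u <- s] /\
  total_length [seq (clamp a b u.1, clamp a b u.2) | u <- s] <= total_length s.
Proof.
move=> ab /andP[/allP s12 sp]; split.
  apply/andP; split; first by apply/allP => _ /mapP[u us ->] /=; apply: clamp_mono; exact: s12.
  rewrite pairwise_map; apply: sub_pairwise sp => u v /=.
  by case/orP => /(clamp_mono a b) ->; rewrite ?orbT.
rewrite /total_length big_map big_seq [leRHS]big_seq; apply: ler_sum => u us /=.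
by apply: clamp_lip => //; exact: s12.
Qed.

Lemma abs_contB h1 h2 : abs_cont h1 -> abs_cont h2 -> abs_cont (h1 \- h2).
Proof.
move=> H1 H2 e e0; have e20 : 0 < e / 2 by rewrite divr_gt0.
have [d1 d10 Hd1] := H1 _ e20; have [d2 d20 Hd2] := H2 _ e20.
exists (Num.min d1 d2) => [|s ns]; first by rewrite lt_min d10.
rewrite lt_min => /andP[/(Hd1 _ ns) sd1 /(Hd2 _ ns) sd2].
apply: (@le_lt_trans _ _ (\sum_(u <- s) (`|h1 u.2 - h1 u.1| + `|h2 u.2 - h2 u.1|))).
  apply: ler_sum => u _ /=; rewrite (_ : h1 u.2 - h2 u.2 - (h1 u.1 - h2 u.1) = (h1 u.2 - h1 u.1) - (h2 u.2 - h2 u.1)); last by ring.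
  exact: ler_normB.
by rewrite big_split /=; lra.
Qed.

(** $V$ is the variation of $h$ from $a$ up to the clamped point. Its absolute continuity is
    [family_total_variation_le], used with [e / 2] because that bound is not strict. *)
Lemma abs_cont_variation h a b : a <= b -> abs_cont h -> (h =1 h \o clamp a b) ->
  exists V : R -> R, [/\ {homo V : x y / x <= y}, abs_cont V &
    forall x y, x <= y -> `|h y - h x| <= V y - V x].
Proof.
move=> ab ach hc; pose c := clamp a b.
have ac x : a <= c x by case/andP: (clamp_bounds x ab).
have fin x : total_variation a (c x) h \is a fin_num by apply: abs_cont_bounded_variation.
pose V x := fine (total_variation a (c x) h).
have VB x y : x <= y -> (V y - V x)%:E = total_variation (c x) (c y) h.
  move=> xy; have cxy : c x <= c y by exact: clamp_mono.
  have := total_variationD h (ac x) cxy; rewrite /V.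
  move: (fin x) (fin y) (abs_cont_bounded_variation ach cxy).
  case: total_variation => //= r _; case: total_variation => //= s _; case: total_variation => //= t _.
  by move=> [->]; congr EFin; lra.
have VE x y : x <= y -> `|h y - h x| <= V y - V x.
  move=> xy; rewrite -lee_fin VB// (hc y) (hc x).
  by apply: total_variation_ge; exact: clamp_mono.
have ndV : {homo V : x y / x <= y}.
  by move=> x y xy; rewrite -subr_ge0; apply: le_trans (VE _ _ xy).
exists V; split => // e e0.
have [d d0 Hd] := ach _ (divr_gt0 e0 (ltr0n _ 2)).
exists d => // s ns sd; have [ncs lcs] := nonoverlapping_clamp ab ns.
have := @family_total_variation_le _ h (e / 2) d _ _ [::].
move=> /(_ _ [seq (clamp a b u.1, clamp a b u.2) | u <- s]).
rewrite cats0 big_nil adde0 big_map => H.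
apply: (@le_lt_trans _ _ (e / 2)); last by lra.
rewrite -lee_fin; apply: le_trans (H _ ncs (le_lt_trans lcs sd)); last first.
  by move=> t nt td; apply/ltW/Hd.
rewrite -sumEFin big_seq [leRHS]big_seq; apply: lee_sum => u us /=.
have u12 : u.1 <= u.2 by case/andP: ns => /allP/(_ _ us).
by rewrite -VB// ger0_norm// subr_ge0 ndV.
Qed.

(** Jordan decomposition: $k=V-(V-k)$ is a difference of two nondecreasing absolutely continuous
    functions, each with a density. The derivative almost everywhere is Lebesgue differentiation of
    the indefinite integral, which equals $h-h(a)$ on $]a,b[$. *)
Theorem abs_continuous_FTC a b h : a < b -> @abs_continuous R R^o a b h ->
  exists f : R -> R, [/\ mu.-integrable setT (EFin \o f),
    {ae mu, forall x, a < x < b -> is_derive x 1 h (f x)} &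
    (\int[mu]_(x in `[a, b]) (f x)%:E = (h b - h a)%:E)%E].
Proof.
move=> ab ach; have leab := ltW ab; pose k := h \o clamp a b.
have ack : abs_cont k := abs_cont_clamp leab ach.
have kc : k =1 k \o clamp a b.
  by move=> x; rewrite /k /= (@clamp_id _ _ _ (clamp a b x))// clamp_bounds.
have kE x : a <= x <= b -> k x = h x by move=> axb; rewrite /k /= clamp_id.
have [V [ndV acV VE]] := abs_cont_variation leab ack kc.
have ndG : {homo V \- k : x y / x <= y}.
  by move=> x y xy /=; have := VE _ _ xy; rewrite ler_norml => /andP[]; lra.
have [fV ifV fVE] := nondecreasing_abs_cont_density a b ndV acV.
have [fG ifG fGE] := nondecreasing_abs_cont_density a b ndG (abs_contB acV ack).
pose f := fV \- fG; have fi : mu.-integrable setT (EFin \o f).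
  rewrite (_ : _ \o _ = (EFin \o fV) \- (EFin \o fG))%E; first exact: integrableB.
  by apply/funext => x /=; rewrite EFinB.
have fE x : a <= x <= b -> (\int[mu]_(t in `]a, x]) (f t)%:E = (h x - h a)%:E)%E.
  move=> axb; under eq_integral do rewrite EFinB.
  rewrite integralB//=; [|exact: integrableS ifV|exact: integrableS ifG].
  rewrite -fVE// -fGE// -EFinB /= !kE//; last by rewrite lexx leab.
  by congr EFin; ring.
exists f; split => //; last first.
  rewrite -integral_itv_obnd_cbnd ?fE ?lexx ?leab//.
  by apply: measurable_funS (measurable_int _ fi).
have locf : locally_integrable setT f by apply: open_integrable_locally => //; exact: openT.
have fiy y : mu.-integrable [set` Interval (BRight a) (BRight y)] (EFin \o f).
  by apply: integrableS fi => //; exact: measurable_itv.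
have := FTC1 fiy locf.
apply: filterS; first exact: (ae_filter_ringOfSetsType mu).
move=> x + /andP[ax xb]; have axo : (BRight a < BRight x)%O by rewrite bnd_simp.
move=> /(_ axo)[dF Fx].
set F := (fun x => _) in dF Fx.
apply: (@near_eq_is_derive _ _ _ (fun y => h a + F y)).
  have xab : x \in `]a, b[ by rewrite in_itv/= ax.
  near=> y; have : y \in `]a, b[ by near: y; exact: near_in_itvoo.
  rewrite in_itv/= => /andP[ay yb].
  by rewrite /F /Rintegral fE ?(ltW ay) ?(ltW yb)//=; lra.
rewrite -[f x]add0r; apply: is_deriveD.
by apply: DeriveDef; [exact: dF|rewrite -derive1E; exact: Fx].
Unshelve. all: by end_near. Qed.

End FundamentalTheorem.

(** * Integrals of non-measurable functions *)

Section IntegralComparison.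
Import HBNNSimple.
Context d (T : measurableType d) {R : realType} (mu : {measure set T -> \bar R}).
Local Open Scope ereal_scope.
Implicit Types (f g : T -> \bar R) (D E : set T).

(** The integral of a nonnegative function is a supremum over the simple functions below it. A
    simple function below [f], set to zero on the null set [E], keeps its integral and lies below
    [g]. *)
Lemma ge0_ae_le_integral f g E : measurable E -> mu E = 0 ->
  (forall x, 0 <= f x) -> (forall x, 0 <= g x) ->
  (forall x, ~ E x -> f x <= g x) ->
  \int[mu]_x f x <= \int[mu]_x g x.
Proof.
move=> mE E0 f0 g0 fg; rewrite [leLHS]ge0_integralTE//.
apply: ge_ereal_sup => _ [h hf <-].
have mCE : measurable (~` E) by exact: measurableC.
rewrite -integralT_nnsfun.
have -> : \int[mu]_x (h x)%:E = \int[mu]_x ((proj_nnsfun h mCE) x)%:E.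
  apply: ae_eq_integral => //; try exact/measurable_EFinP.
  exists E; split => // x /= nhx; apply: contrapT => Ex; apply: nhx => _.
  by rewrite mindicE mem_set// mulr1.
rewrite integralT_nnsfun [leRHS]ge0_integralTE//; apply: ereal_sup_ubound.
exists (proj_nnsfun h mCE) => // x /=; rewrite mindicE.
have [Ex|Ex] := pselect (E x).
  by rewrite memNset ?mulr0//=; apply.
by rewrite mem_set// mulr1; apply: le_trans (hf x) (fg _ Ex).
Qed.

Lemma ae_le_integral f g D : measurable D ->
  {ae mu, forall x, D x -> f x <= g x} ->
  \int[mu]_(x in D) f x <= \int[mu]_(x in D) g x.
Proof.
move=> mD [E [mE E0 fgE]].
have fg x : ~ E x -> (f \_ D) x <= (g \_ D) x.
  move=> Ex; rewrite !patchE; case: ifPn => // /set_mem Dx.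
  by apply: contrapT => nfg; apply: Ex; apply: fgE => /= /(_ Dx).
rewrite [leLHS]integral_mkcond [leRHS]integral_mkcond [leLHS]integralE [leRHS]integralE.
apply: leeB; apply: (ge0_ae_le_integral mE E0) => // x Ex.
- by rewrite !funeposE ge_max le_max fg//= le_max lexx orbT.
- by rewrite !funenegE ge_max le_max leeN2 fg//= le_max lexx orbT.
Qed.

End IntegralComparison.

(** * Charts and velocities *)

Lemma diff_compE (R : numFieldType) (U V W : normedModType R) (f : U -> V)
    (g : V -> W) (x v : U) (y : V) : y = f x -> differentiable f x ->
  differentiable g y -> 'd (g \o f) x v = 'd g y ('d f x v).
Proof. by move=> -> df dg; rewrite diff_comp. Qed.

Lemma diff_near_cancel (R : numFieldType) (U V : normedModType R) (f : U -> V)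
    (g : V -> U) (x v : U) (y : V) : y = f x -> differentiable f x ->
  differentiable g y -> (\forall x' \near x, g (f x') = x') -> 'd g y ('d f x v) = v.
Proof.
move=> yE df dg gf; rewrite -(diff_compE _ yE)//.
rewrite -deriveE; last by apply: differentiable_comp => //; rewrite -yE.
by rewrite (@near_eq_derive _ _ _ _ id)// derive_id.
Qed.

Section Charts.
Context {R : realType} {m : nat} {M : smoothManifold R m}.
Implicit Types (i j : chart_index M) (x : M) (y w : 'rV[R]_m.+1).

Lemma chart_img_map i x : chart_dom i x -> chart_img i (chart_map i x).
Proof. by exists x. Qed.

Lemma chart_invK i y : chart_img i y -> chart_map i (chart_inv i y) = y.
Proof. by case=> x ix <-; rewrite chart_mapK. Qed.

Lemma chart_inv_dom i y : chart_img i y -> chart_dom i (chart_inv i y).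
Proof. by case=> x ix <-; rewrite chart_mapK. Qed.

Lemma chart_map_cts i x : chart_dom i x -> {for x, continuous (chart_map i)}.
Proof.
move=> ix; have := @chart_map_continuous R m M i.
by rewrite continuous_open_subspace; [apply; rewrite inE|exact: chart_dom_open].
Qed.

Lemma chart_inv_cts i y : chart_img i y -> {for y, continuous (chart_inv i)}.
Proof.
move=> iy; have := @chart_inv_continuous R m M i.
by rewrite continuous_open_subspace; [apply; rewrite inE|exact: chart_img_open].
Qed.

Lemma near_chart_dom i x : chart_dom i x -> \forall x' \near x, chart_dom i x'.
Proof. by move=> ix; apply: open_nbhs_nbhs; split => //; exact: chart_dom_open. Qed.

Lemma near_chart_img i y : chart_img i y -> \forall y' \near y, chart_img i y'.
Proof. by move=> iy; apply: open_nbhs_nbhs; split => //; exact: chart_img_open. Qed.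

Lemma near_chart i x (P : M -> Prop) : chart_dom i x ->
  (\forall y \near chart_map i x, P (chart_inv i y)) -> \forall x' \near x, P x'.
Proof.
move=> ix nP; have nP' := chart_map_cts ix nP.
near=> x'; have ix' : chart_dom i x' by near: x'; exact: near_chart_dom.
by rewrite -(chart_mapK ix'); near: x'; exact: nP'.
Unshelve. all: by end_near. Qed.

Lemma transition_differentiable i j x : chart_dom i x -> chart_dom j x ->
  differentiable (chart_map j \o chart_inv i) (chart_map i x).
Proof.
move=> ix jx; have [+ _] := @chart_transition_smooth R m M i j 1.
by apply; split; [exact: chart_img_map|rewrite /= chart_mapK].
Qed.

Lemma transition_diffK i j x w : chart_dom i x -> chart_dom j x ->
  'd (chart_map i \o chart_inv j) (chart_map j x)
    ('d (chart_map j \o chart_inv i) (chart_map i x) w) = w.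
Proof.
move=> ix jx.
apply: diff_near_cancel; [by rewrite /= chart_mapK|exact: transition_differentiable..|].
near=> y; have iy : chart_img i y.
  by near: y; apply: near_chart_img; exact: chart_img_map.
have jy : chart_dom j (chart_inv i y).
  near: y; have c := chart_inv_cts (chart_img_map ix).
  by apply: c; rewrite chart_mapK//; exact: near_chart_dom.
by rewrite /= chart_mapK// chart_invK.
Unshelve. all: by end_near. Qed.

Lemma tcoordK i x (v : tangent x) : chart_dom i x -> tvec i x (tcoord i v) = v.
Proof. by move=> ix; apply: transition_diffK => //; exact: chart_atP. Qed.

Lemma tvecK i x w : chart_dom i x -> tcoord i (tvec i x w) = w.
Proof. by move=> ix; apply: transition_diffK => //; exact: chart_atP. Qed.

(** By continuity the curve stays in the domain of [i] near [s], so there its coordinates in the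
    chart chosen at [z s] are a transition map applied to those in [i], and the chain rule
    applies. *)
Lemma velocity_tcoord i (z : R -> M) (s : R) w : chart_dom i (z s) ->
  {for s, continuous z} -> is_derive s 1 (chart_map i \o z) w ->
  tcoord i (velocity z s) = w.
Proof.
move=> izs cz dz; rewrite -[RHS](tvecK _ izs); congr tcoord.
have dc : differentiable (chart_map i \o z) s by apply/derivable1_diffP; exact: ex_derive.
have dt : differentiable (chart_map (chart_at (z s)) \o chart_inv i) ((chart_map i \o z) s).
  by apply: transition_differentiable => //; exact: chart_atP.
rewrite /velocity derive1E.
rewrite (@near_eq_derive _ _ _ _ ((chart_map (chart_at (z s)) \o chart_inv i) \o (chart_map i \o z))).
  rewrite deriveE; last exact: differentiable_comp.
  rewrite (diff_compE _ erefl dc dt); congr ('d _ _ _).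
  by rewrite -(deriveE _ dc) derive_val.
near=> r; have izr : chart_dom i (z r).
  by near: r; apply: cz; exact: near_chart_dom.
by rewrite /= chart_mapK.
Unshelve. all: by end_near. Qed.

End Charts.

Lemma within_itv_continuous (R : realType) (T : topologicalType) (z : R -> T) (a b s : R) :
  {within `[a, b], continuous z} -> a < s < b -> {for s, continuous z}.
Proof.
move=> cz sab; have : {within `]a, b[, continuous z}.
  by apply: continuous_subspaceW cz; exact: subset_itv_oo_cc.
by rewrite continuous_open_subspace; [apply; rewrite inE/= in_itv|exact: interval_open].
Qed.

Section RowVectors.
Context {R : realType} {n : nat}.
Implicit Types (w : 'rV[R]_n).

Lemma coord_le_norm w k : `|w 0 k| <= `|w|.
Proof.
rewrite {2}/Num.norm/= mx_normrE.
by rewrite (le_bigmax _ (fun ij => `|w ij.1 ij.2|) (0, k)).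
Qed.

Lemma norm_le_coord w c : 0 <= c -> (forall k, `|w 0 k| <= c) -> `|w| <= c.
Proof.
move=> c0 wc; rewrite /Num.norm/= mx_normrE; apply: bigmax_le => // -[i k] _ /=.
by rewrite ord1.
Qed.

Lemma norm_coord_attained w : w != 0 -> exists k, `|w| = `|w 0 k|.
Proof.
move=> w0; have [|[i k] wk] := @mx_norm_neq0 _ _ _ w.
  by apply: contra w0 => /eqP/mx_norm_eq0/eqP.
by exists k; rewrite {1}/Num.norm/= wk ord1.
Qed.

End RowVectors.

(** * The fundamental theorem along a curve in one chart *)

Section CurveFTC.
Context {R : realType} {m : nat} {M : smoothManifold R m}.
Local Notation mu := (@lebesgue_measure R).

Lemma abs_continuous_coord (h : R -> 'rV[R]_m.+1) a b k :
  abs_continuous a b h -> @abs_continuous R R^o a b (fun s => h s 0 k).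
Proof.
move=> H e e0; have [d d0 Hd] := H e e0; exists d => // n l r lr tr lt_.
apply: le_lt_trans (Hd n l r lr tr lt_); apply: ler_sum => j _.
by have := coord_le_norm (h (r j) - h (l j)) k; rewrite !mxE.
Qed.

Lemma curve_FTC (i : chart_index M) (z : R -> M) (a b : R) : a < b ->
  {within `[a, b], continuous z} -> (forall s, a <= s <= b -> chart_dom i (z s)) ->
  abs_continuous a b (chart_map i \o z) ->
  exists f : R -> 'rV[R]_m.+1,
  [/\ forall k, mu.-integrable setT (fun s => (f s 0 k)%:E),
      {ae mu, forall s, a < s < b -> tcoord i (velocity z s) = f s} &
      forall k, (\int[mu]_(s in `[a, b]) (f s 0 k)%:E
                  = (chart_map i (z b) 0 k - chart_map i (z a) 0 k)%:E)%E].
Proof.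
move=> ab cz iz acz.
have /choice[f fP] k := abs_continuous_FTC ab (abs_continuous_coord k acz).
exists (fun s => \row_k f k s); split.
- move=> k; have [+ _ _] := fP k; congr (is_true (integrable _ _ _)).
  by apply/funext => s; rewrite mxE.
- have : {ae mu, forall s k, a < s < b -> is_derive s 1 (fun s => (chart_map i \o z) s 0 k) (f k s)}.
    apply: (@filter_forall _ _ _ _ (ae_filter_ringOfSetsType mu)) => k.
    by have [_ + _] := fP k.
  apply: (@filterS _ _ (ae_filter_ringOfSetsType mu)) => s df sab; apply: velocity_tcoord.
  + by apply: iz; move: sab => /andP[/ltW -> /ltW ->].
  + exact: within_itv_continuous cz sab.
  + have dz : derivable (chart_map i \o z) s 1.
      by apply/derivable_mxP => i0 k; rewrite ord1; have [] := df k sab.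
    apply: DeriveDef => //; rewrite derive_mx//; apply/rowP => k; rewrite !mxE.
    by have [_ ->] := df k sab.
- move=> k; have [_ _ <-] := fP k; apply: eq_integral => s _; by rewrite mxE.
Qed.

End CurveFTC.

(** * The metric in a chart *)

Lemma cvg_sum (R : realType) (V : normedModType R) (T I : Type)
    (F : set_system T) {FF : Filter F} (r : seq I) (f : I -> T -> V) (l : I -> V) :
  (forall i, f i t @[t --> F] --> l i) ->
  \sum_(i <- r) f i t @[t --> F] --> \sum_(i <- r) l i.
Proof.
move=> fl; elim: r => [|i r IH].
  by rewrite big_nil; under eq_fun do rewrite big_nil; exact: cvg_cst.
by rewrite big_cons; under eq_fun do rewrite big_cons; exact: cvgD.
Qed.

Section TangentLinear.
Context {R : realType} {m : nat} {M : smoothManifold R m}.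
Implicit Types (i : chart_index M) (x : M) (w : 'rV[R]_m.+1).
Local Notation e k := (delta_mx 0 k : 'rV[R]_m.+1).

Lemma tvecZ i x (c : R) w : tvec i x (c *: w) = c *: tvec i x w.
Proof. exact: linearZ. Qed.

Lemma tcoordD i x (v1 v2 : tangent x) : tcoord i (v1 + v2) = tcoord i v1 + tcoord i v2.
Proof. exact: raddfD. Qed.

Lemma tcoordZ i x (c : R) (v : tangent x) : tcoord i (c *: v) = c *: tcoord i v.
Proof. exact: linearZ. Qed.

Lemma tvec_sum i x w : tvec i x w = \sum_k w 0 k *: tvec i x (e k).
Proof.
rewrite {1}[w]row_sum_delta /tvec raddf_sum; apply: eq_bigr => k _.
exact: linearZ.
Qed.

Lemma scalar_tvec i x (f : {scalar tangent x}) w :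
  f (tvec i x w) = \sum_k w 0 k * f (tvec i x (e k)).
Proof.
rewrite tvec_sum raddf_sum; apply: eq_bigr => k _; exact: linearZ.
Qed.

Variable g : riemannian_metric M.

Lemma metric_tvec i x w : g x (tvec i x w) (tvec i x w) =
  \sum_k \sum_l w 0 k * w 0 l * g x (tvec i x (e k)) (tvec i x (e l)).
Proof.
rewrite scalar_tvec; apply: eq_bigr => k _.
rewrite metric_form_sym scalar_tvec mulr_sumr; apply: eq_bigr => l _.
by rewrite mulrA.
Qed.

Lemma metric_tvec_pos i x w : chart_dom i x -> w != 0 ->
  0 < g x (tvec i x w) (tvec i x w).
Proof.
move=> ix w0; apply: metric_form_pos; apply: contra w0 => /eqP tw0.
by rewrite -(tvecK w ix) tw0; apply/eqP; exact: raddf0.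
Qed.

(** The constant is the minimum of the quadratic form on the compact unit sphere; homogeneity
    extends the bound. *)
Lemma metric_lower_bound_at i x : chart_dom i x -> exists2 c, 0 < c &
  forall w, c * `|w| ^+ 2 <= g x (tvec i x w) (tvec i x w).
Proof.
move=> ix; pose f w := g x (tvec i x w) (tvec i x w) : R.
pose S := [set w : 'rV[R]_m.+1 | `|w| = 1].
have S0 : S !=set0.
  exists (const_mx 1); apply/eqP; rewrite eq_le; apply/andP; split.
    by apply: norm_le_coord => // k; rewrite mxE normr1.
  by have := coord_le_norm (const_mx 1 : 'rV[R]_m.+1) 0; rewrite mxE normr1.
have cS : compact S.
  apply: bounded_closed_compact; first by exists 1; split => // M1 M1lt w /= ->; exact: ltW.
  rewrite (_ : S = (Num.norm : _ -> R^o) @^-1` [set 1]); last by [].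
  by apply: preimage_closed => // w _; exact: norm_continuous.
have cf : continuous (f : _ -> R^o).
  move=> w; rewrite /f; under eq_fun do rewrite metric_tvec.
  apply: (@cvg_sum _ R^o _ _ (nbhs w)) => k; apply: (@cvg_sum _ R^o _ _ (nbhs w)) => l.
  by apply: (@cvgM R _ (nbhs w) _); [apply: (@cvgM R _ (nbhs w) _); exact: coord_continuous|exact: cvg_cst].
have [w0 /set_mem w0S w0min] := EVT_min_rV S0 cS (continuous_subspaceT cf).
exists (f w0).
  by apply: metric_tvec_pos => //; rewrite -normr_gt0 w0S.
move=> w; have [->|wn0] := eqVneq w 0.
  rewrite normr0 expr0n mulr0 (_ : tvec i x 0 = 0); last exact: raddf0.
  by rewrite raddf0.
have nw : 0 < `|w| by rewrite normr_gt0.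
have := w0min (`|w|^-1 *: w).
rewrite inE /S/= normrZ normfV normr_id mulVf ?gt_eqF// => /(_ erefl).
rewrite {2}/f tvecZ [X in _ <= X](linearZ) metric_form_sym linearZ /=.
by rewrite mulrA -expr2 exprVn ler_pdivlMl ?exprn_gt0// mulrC.
Qed.

Lemma metric_lower_bound i x : chart_dom i x -> exists2 c, 0 < c &
  \forall x' \near x, forall v : tangent x', c * `|tcoord i v| <= tnorm g v.
Proof.
move=> ix; have [c c0 cP] := metric_lower_bound_at ix.
exists (Num.sqrt (c / 2)); first by rewrite sqrtr_gt0 divr_gt0.
pose G (k l : 'I_m.+1) y := g (chart_inv i y) (tvec i (chart_inv i y) (e k)) (tvec i (chart_inv i y) (e l)) : R.
(* The form has [m.+1 ^ 2] coefficients: if each moves by less than [eta], the form moves by at most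
   $(c/2)|w|^2$, and half of the constant at [x] survives. *)
have [eta eta0 etaE] : exists2 eta, 0 < eta & eta * (m.+1 ^ 2)%:R = c / 2.
  exists (c / 2 / (m.+1 ^ 2)%:R); first by rewrite !divr_gt0// ltr0n expn_gt0.
  by rewrite divfK// pnatr_eq0 expn_eq0.
have nG : \forall y \near chart_map i x, forall kl : 'I_m.+1 * 'I_m.+1,
    `|G kl.1 kl.2 (chart_map i x) - G kl.1 kl.2 y| < eta.
  apply: (filter_forall (@nbhs_filter _ (chart_map i x)) _) => -[k l].
  have /= cG := metric_form_smooth g i (e k) (e l) 0.
  exact: (@cvgr_dist_lt _ R^o _ _ _ _ _ (cG _ (chart_img_map ix)) _ eta0).
have nI := near_chart_img (chart_img_map ix).
apply: (near_chart ix); near=> y => v.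
have iy : chart_img i y by near: y; exact: nI.
have id : chart_dom i (chart_inv i y) := chart_inv_dom iy.
have Gy : forall kl : 'I_m.+1 * 'I_m.+1, `|G kl.1 kl.2 (chart_map i x) - G kl.1 kl.2 y| < eta by near: y; exact: nG.
set w := tcoord i v; rewrite -[v](tcoordK _ id) -/w /tnorm.
rewrite -[X in _ * X]normr_id -sqrtr_sqr -sqrtrM ?divr_ge0 ?(ltW c0)// ler_wsqrtr//.
have half (a n GA GB A B : R) : a * n <= GA -> GA = A -> GB = B ->
  A - B <= a / 2 * n -> a / 2 * n <= GB by lra.
apply: (half _ _ _ _ _ _ (cP w) (metric_tvec i x w) (metric_tvec i (chart_inv i y) w)).
rewrite -sumrB.
apply: (@le_trans _ _ (\sum_(k < m.+1) \sum_(l < m.+1) eta * `|w| ^+ 2)); last first.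
  by rewrite !sumr_const !card_ord -mulrnA mulnn -[leLHS]mulr_natr [leLHS]mulrAC etaE.
apply: ler_sum => k _; rewrite -sumrB; apply: ler_sum => l _.
rewrite -mulrBr; apply: le_trans (ler_norm _) _; rewrite !normrM mulrC.
apply: ler_pM; [exact: normr_ge0|exact: mulr_ge0| |].
  by apply: ltW; have := Gy (k, l); rewrite /G /= (chart_mapK ix).
by rewrite expr2; apply: ler_pM => //; exact: coord_le_norm.
Unshelve. all: by end_near. Qed.

End TangentLinear.

(** * Riemannian distance and topology *)

Section Lipschitz.
Context {R : realType} {n : nat}.
Implicit Types (f : R -> 'rV[R]_n.+1) (a b c : R).

Definition lipschitz_on a b f := exists2 k, 0 <= k &
  forall s t, a <= s -> s <= t -> t <= b -> `|f t - f s| <= k * (t - s).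

Lemma lipschitz_abs_continuous a b f : lipschitz_on a b f -> abs_continuous a b f.
Proof.
move=> [k k0 fk] e e0; have k10 : 0 < k + 1 by apply: ltr_wpDl.
exists (e / (k + 1)); first exact: divr_gt0.
move=> N l r lr _ sd; apply: (@le_lt_trans _ _ ((k + 1) * \sum_(j < N) (r j - l j))).
  rewrite mulr_sumr; apply: ler_sum => j _; have [al lr_ rb] := lr j.
  by apply: le_trans (fk _ _ al lr_ rb) _; rewrite ler_wpM2r ?subr_ge0// lerDl.
by rewrite mulrC -ltr_pdivlMr.
Qed.

Lemma lipschitz_on_cat a c b f : a <= c <= b ->
  lipschitz_on a c f -> lipschitz_on c b f -> lipschitz_on a b f.
Proof.
move=> /andP[ac cb] [k1 k10 f1] [k2 k20 f2]; exists (Num.max k1 k2).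
  by rewrite le_max k10.
move=> s t as_ st tb.
have k1m : k1 <= Num.max k1 k2 by rewrite le_max lexx.
have k2m : k2 <= Num.max k1 k2 by rewrite le_max lexx orbT.
have [tc|ct] := leP t c.
  by apply: le_trans (f1 _ _ as_ st tc) _; rewrite ler_wpM2r ?subr_ge0.
have [sc|cs] := leP s c; last first.
  by apply: le_trans (f2 _ _ (ltW cs) st tb) _; rewrite ler_wpM2r ?subr_ge0.
rewrite (_ : f t - f s = (f t - f c) + (f c - f s)); last by rewrite addrA subrK.
apply: le_trans (ler_normD _ _) _.
rewrite (_ : t - s = (t - c) + (c - s)); last by ring.
rewrite mulrDr lerD//.
  by apply: le_trans (f2 _ _ (lexx _) (ltW ct) tb) _; rewrite ler_wpM2r ?subr_ge0// ltW.
by apply: le_trans (f1 _ _ as_ sc (lexx _)) _; rewrite ler_wpM2r ?subr_ge0.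
Qed.

Lemma eq_lipschitz_on a b f1 f2 : (forall s, a <= s <= b -> f1 s = f2 s) ->
  lipschitz_on a b f1 -> lipschitz_on a b f2.
Proof.
move=> f12 [k k0 fk]; exists k => // s t as_ st tb.
rewrite -!f12 ?as_ ?(le_trans st)// ?tb ?(le_trans as_)//; exact: fk.
Qed.

(** The mean value theorem is scalar, but the norm on rows is the maximum of the coordinates, so
    applying it to each coordinate suffices. *)
Lemma C1_lipschitz_on a b (U : set R) f : @Ck R R^o 'rV[R]_n.+1 1 U f ->
  (forall s, a <= s <= b -> U s) -> lipschitz_on a b f.
Proof.
move=> [dfU cfU] abU; have [ab|ba] := leP a b; last first.
  by exists 0 => // s t as_ st tb; exfalso; have := le_trans (le_trans as_ st) tb; lra.
pose D (s : R) := 'd (f : R^o -> _) s 1.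
have cD : {within `[a, b], continuous (fun s => `|D s| : R)}.
  apply: continuous_in_subspaceT => s /set_mem /=; rewrite in_itv/= => sab.
  have := cfU 1 s (abU s sab) => /(@cvg_norm _ _ _ _ _ _ _); exact.
have [c _ cmax] := EVT_max ab cD.
exists `|D c| => // s t as_ st tb; apply: norm_le_coord.
  by rewrite mulr_ge0// subr_ge0.
move=> k; rewrite !mxE.
have dfk u : a <= u <= b -> is_derive u 1 (fun u => f u 0 k) (D u 0 k).
  move=> uab; have du : derivable (f : R^o -> _) u 1 by apply: diff_derivable; apply: dfU; exact: abU.
  apply: DeriveDef; first by move/derivable_mxP : du => /(_ 0 k).
  rewrite /D -deriveE; last by apply: dfU; exact: abU.
  by rewrite derive_mx// mxE.
have [||u uab ->] := @MVT_segment R (fun u => f u 0 k) (fun u => D u 0 k) s t st.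
- move=> u; rewrite in_itv/= => /andP[su ut]; apply: dfk; apply/andP; split; lra.
- apply: derivable_within_continuous => u; rewrite in_itv/= => /andP[su ut].
  by apply: ex_derive; apply: dfk; apply/andP; split; lra.
rewrite normrM (ger0_norm (_ : 0 <= t - s)) ?subr_ge0// ler_wpM2r ?subr_ge0//.
apply: le_trans (coord_le_norm _ _) _; apply: cmax.
by move: uab; rewrite !in_itv/= => /andP[su ut]; apply/andP; split; lra.
Qed.

End Lipschitz.

Section PiecewiseC1.
Context {R : realType} {m : nat} {M : smoothManifold R m}.

Lemma piecewise_C1_abs_continuous (i : chart_index M) (z : R -> M) (a : R) :
  piecewise_C1 z -> 0 <= a -> (forall s, a <= s <= 1 -> chart_dom i (z s)) ->
  abs_continuous a 1 (chart_map i \o z).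
Proof.
move=> [_ [n [t [t0 tn tP]]]] a0 iz; apply: lipschitz_abs_continuous.
have t_mono k l : (k <= l)%N -> (l <= n)%N -> t k <= t l.
  elim: l => [|l IH]; first by rewrite leqn0 => /eqP ->.
  rewrite leq_eqVlt => /predU1P[->//|kl ln].
  by apply: le_trans (IH kl (ltnW ln)) _; have [/ltW] := tP _ ln.
have empty b : b <= a -> lipschitz_on a b (chart_map i \o z).
  move=> ba; exists 0 => // s r as_ sr rb.
  have -> : r = s by lra.
  by rewrite !subrr normr0 mulr0.
suff H k : (k <= n)%N -> lipschitz_on a (t k) (chart_map i \o z) by rewrite -tn; exact: H.
elim: k => [_|k IH kn]; first by apply: empty; rewrite t0.
have [ta|at_] := leP (t k.+1) a; first exact: empty.
have [tk [J [zk [[oJ czk C1zk] JI zE]]]] := tP _ kn.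
have tk1 : t k.+1 <= 1 by rewrite -tn t_mono.
have tk0 : 0 <= t k by rewrite -t0 t_mono// ltnW.
(* The current smooth piece may begin before [a]; only its part after [a] lies in the chart. *)
pose c := Num.max a (t k).
have ac : a <= c by rewrite le_max lexx.
have tc : t k <= c by rewrite le_max lexx orbT.
have ct : c <= t k.+1 by rewrite ge_max !ltW.
apply: (@lipschitz_on_cat _ _ _ c); first by rewrite ac.
  rewrite /c; case: (leP (t k) a) => ?; first by apply: empty; lra.
  exact: IH (ltnW kn).
have zEc s : c <= s <= t k.+1 -> z s = zk s.
  by move=> /andP[cs st]; apply: zE; rewrite in_itv/= st andbT (le_trans tc).
apply: (@eq_lipschitz_on _ _ _ _ (chart_map i \o zk)).
  by move=> s /zEc /= ->.
apply: C1_lipschitz_on (C1zk i) _ => s sc; split.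
  by apply: JI; rewrite /= in_itv/=; lra.
by rewrite /= -zEc//; apply: iz; lra.
Qed.

End PiecewiseC1.

Section DistanceTopology.
Context {R : realType} {m : nat} {M : smoothManifold R m}.
Variable g : riemannian_metric M.
Local Notation mu := (@lebesgue_measure R).

(** A single coordinate attains the norm of the displacement, and the length dominates [c] times the
    integral of the absolute value of its derivative over $[a,1]$. *)
Lemma curve_length_ge (i : chart_index M) (z : R -> M) (a c : R) :
  piecewise_C1 z -> 0 <= a -> a < 1 -> (forall s, a <= s <= 1 -> chart_dom i (z s)) ->
  0 <= c -> (forall s, a <= s <= 1 -> forall v : tangent (z s), c * `|tcoord i v| <= tnorm g v) ->
  ((c * `|chart_map i (z 1) - chart_map i (z a)|)%:E <= curve_length g z)%E.
Proof.
move=> pz a0 a1 iz c0 cg.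
have cz : {within `[a, 1], continuous z}.
  by case: pz => + _; apply: continuous_subspaceW => s /=; rewrite !in_itv/=; lra.
have [f [fi fv fI]] := curve_FTC a1 cz iz (piecewise_C1_abs_continuous pz a0 iz).
have [->|dn0] := eqVneq (chart_map i (z 1) - chart_map i (z a)) 0.
  rewrite normr0 mulr0; apply: integral_ge0 => s _; rewrite lee_fin; exact: sqrtr_ge0.
have [k ->] := norm_coord_attained dn0; rewrite !mxE.
have mab : measurable (`]a, 1[ : set (measurableTypeR R)) by exact: measurable_itv.
have m01 : measurable (`[0, 1] : set (measurableTypeR R)) by exact: measurable_itv.
pose h (s : measurableTypeR R) := (c * `|f s 0 k|)%:E.
have mh : measurable_fun setT h.
  apply/measurable_EFinP; apply: measurable_funM => //; apply: measurableT_comp => //.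
  by have /measurable_int/measurable_EFinP := fi k.
(* Before [a] the curve may be outside the chart, so the minorant is set to zero there. *)
have step : (\int[mu]_(s in `[0%R, 1%R]) (h \_ `]a, 1%R[) s <= curve_length g z)%E.
  apply: ae_le_integral => //; apply: (@filterS _ _ (ae_filter_ringOfSetsType mu)) fv.
  move=> s sv s01; rewrite patchE.
  have [/set_mem|_] := boolP (s \in `]a, 1[%classic); last by rewrite lee_fin sqrtr_ge0.
  rewrite /= in_itv/= => as1; rewrite /h lee_fin -(sv as1).
  have as1' : a <= s <= 1 by lra.
  by apply: le_trans (cg _ as1' _); rewrite ler_wpM2l//; exact: coord_le_norm.
apply: le_trans step.
rewrite -integral_mkcondr setIidr; last first.
  by move=> s /=; rewrite !in_itv/=; lra.
rewrite -(@integral_itv_bndoo _ _ _ _ true false); last exact: measurable_funS mh.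
have -> : (\int[mu]_(s in `[a, 1%R]) h s = c%:E * \int[mu]_(s in `[a, 1%R]) `|(f s 0 k)%:E|)%E.
  rewrite -ge0_integralZl//; apply: measurableT_comp => //.
  by apply: measurable_funTS; exact: measurable_int (fi k).
rewrite EFinM lee_wpmul2l ?lee_fin// -abse_EFin -fI.
by apply: le_abse_integral => //; apply: measurable_funTS; exact: measurable_int (fi k).
Qed.

End DistanceTopology.

Lemma within_itv_near (R : realType) (T : topologicalType) (z : R -> T) (a b s0 : R)
    (A : set T) :
  {within `[a, b], continuous z} -> a <= s0 <= b -> nbhs (z s0) A ->
  exists2 d, 0 < d & forall s, a <= s <= b -> `|s - s0| < d -> A (z s).
Proof.
move=> cz s0ab nA; have := cz s0 _ nA.
rewrite /= /nbhs /= -nbhs_subspace_in; last by rewrite /= in_itv.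
move=> /nbhs_ballP[d /= d0 dA]; exists d => // s sab ss0.
by apply: dA; [rewrite /ball/= distrC|rewrite /= in_itv].
Qed.

Lemma continuous_dist (R : realType) (V : normedModType R) (v : V) :
  continuous (fun y => `|v - y| : R^o).
Proof.
move=> y; apply: (@cvg_norm _ _ _ (nbhs y)).
by apply: (@cvgB _ _ _ (nbhs y)); [exact: cvg_cst|exact: cvg_id].
Qed.

Section DistanceTopology.
Context {R : realType} {m : nat} {M : smoothManifold R m}.
Variable g : riemannian_metric M.

Lemma chart_closed_ball_closed (i : chart_index M) (y0 : 'rV[R]_m.+1) (r : R) :
  (forall y, `|y0 - y| <= r -> chart_img i y) ->
  closed (chart_inv i @` [set y | `|y0 - y| <= r]).
Proof.
move=> ri; apply: compact_closed; first exact: manifold_hausdorff.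
apply: continuous_compact.
  by apply: continuous_in_subspaceT => y /set_mem /= yr; apply: chart_inv_cts; exact: ri.
apply: bounded_closed_compact.
  exists (`|y0| + r); split; first exact: num_real.
  move=> N Nlt y /= yr; apply: le_trans (ltW Nlt).
  rewrite (_ : y = y0 - (y0 - y)); last by rewrite opprB addrCA subrr addr0.
  by apply: le_trans (ler_normB _ _) _; rewrite lerD2l.
rewrite (_ : [set y | _] = (fun y => `|y0 - y| : R^o) @^-1` [set t | t <= r]); last by [].
apply: preimage_closed; last exact: closed_le.
move=> y _; exact: continuous_dist.
Qed.

(* The chart map may jump at the last time tau spent outside the ball.  If z stayed in
   the half ball after tau then so would z tau, the closed half ball being compact and
   hence closed in the Hausdorff space M. *)
Lemma leaves_chart_ball (i : chart_index M) (y0 : 'rV[R]_m.+1) (r : R) (z : R -> M) :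
  0 < r -> (forall y, `|y0 - y| < r -> chart_img i y) ->
  {within `[0, 1], continuous z} ->
  ~ (chart_dom i (z 0) /\ `|y0 - chart_map i (z 0)| < r) ->
  chart_dom i (z 1) -> `|y0 - chart_map i (z 1)| < r / 2 ->
  exists2 a, 0 <= a < 1 & r / 2 < `|y0 - chart_map i (z a)| /\
    forall s, a <= s <= 1 -> chart_dom i (z s) /\ `|y0 - chart_map i (z s)| < r.
Proof.
move=> r0 ri cz z0 iz1 z1.
pose W x := chart_dom i x /\ `|y0 - chart_map i x| < r.
have nW x : W x -> nbhs x W.
  move=> [ix xr]; near=> x'; split; first by near: x'; exact: near_chart_dom.
  near: x'; have c := @continuous_comp _ _ _ _ _ x (chart_map_cts ix) (@continuous_dist _ _ y0 _).
  exact: (@cvgr_lt R _ (nbhs x) _ _ _ c _ xr).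
pose S := [set s | 0 <= s <= 1 /\ ~ W (z s)].
have S0 : S 0 by split; rewrite ?lexx ?ler01.
have Sub : has_ubound S by exists 1 => s [/andP[]].
have hS : has_sup S by split => //; exists 0.
pose tau := sup S.
have tau0 : 0 <= tau by exact: ub_le_sup.
have tau1 : tau <= 1 by apply: ge_sup; [exists 0|move=> s [/andP[]]].
have tau01 : 0 <= tau <= 1 by rewrite tau0.
have ntau : ~ W (z tau).
  move=> /nW/(within_itv_near cz tau01)[d d0 dW].
  have [s Ss sd] := sup_adherent d0 hS; have [s01 nWs] := Ss.
  apply: nWs; apply: dW => //; have := ub_le_sup Sub Ss; rewrite -/tau in sd * => st.
  by rewrite distrC ger0_norm ?subr_ge0//; lra.
have Wz1 : W (z 1) by split => //; apply: lt_trans z1 _; lra.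
have tau_lt1 : tau < 1 by rewrite lt_neqAle tau1 andbT; apply/eqP => t1; apply: ntau; rewrite t1.
have Wz s : tau < s -> s <= 1 -> W (z s).
  move=> ts s1; apply: contrapT => nWs.
  have : s <= tau by apply: ub_le_sup => //; split => //; lra.
  by lra.
have [a [ta a1 ar]] : exists a, [/\ tau < a, a <= 1 & r / 2 < `|y0 - chart_map i (z a)|].
  apply: contrapT => nex.
  have small s : tau < s -> s <= 1 -> `|y0 - chart_map i (z s)| <= r / 2.
    by move=> ts s1; rewrite leNgt; apply/negP => rs; apply: nex; exists s.
  pose F := chart_inv i @` [set y | `|y0 - y| <= r / 2].
  have Fz s : tau < s -> s <= 1 -> F (z s).
    move=> ts s1; exists (chart_map i (z s)); first exact: small.
    by apply: chart_mapK; case: (Wz _ ts s1).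
  have r2i y : `|y0 - y| <= r / 2 -> chart_img i y by move=> yr; apply: ri; lra.
  have cF : closed F by exact: chart_closed_ball_closed.
  have [[y yr yz]|nF] := pselect (F (z tau)).
    apply: ntau; rewrite -yz; split; first exact/chart_inv_dom/r2i.
    by rewrite chart_invK; [move: yr => /=; lra|exact: r2i].
  have nFn : nbhs (z tau) (~` F) by apply: open_nbhs_nbhs; split => //; exact: closed_openC.
  have [d d0 dF] := within_itv_near cz tau01 nFn.
  pose s := Num.min 1 (tau + d / 2).
  have [ts s1 sd] : [/\ tau < s, s <= 1 & s - tau < d].
    by rewrite /s; case: (leP 1 (tau + d / 2)) => ?; split; lra.
  apply: (dF s) (Fz _ ts s1); first by lra.
  by rewrite ger0_norm ?subr_ge0 ?(ltW ts).
exists a.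
  rewrite (le_trans tau0 (ltW ta)) lt_neqAle a1 andbT.
  by apply/eqP => aE; move: ar; rewrite aE; lra.
split => // s /andP[as_ s1]; apply: Wz => //; exact: lt_le_trans as_.
Unshelve. all: by end_near. Qed.

(** A curve from a point outside [U] to a point of [V] has to cross the chart annulus from radius
    $r/2$ to radius $r/4$, which costs length at least $cr/4$. The same [e] serves all centres [x]
    in [V], as is needed for uniform closeness to a curve. *)
Lemma dist_nbhs (x0 : M) (U : set M) : nbhs x0 U ->
  exists2 V, nbhs x0 V & exists2 e, 0 < e &
    forall x y, V x -> (riemannian_dist g y x < e%:E)%E -> U y.
Proof.
move=> nU; pose i := chart_at x0; have ix0 : chart_dom i x0 := chart_atP x0.
pose y0 := chart_map i x0; have iy0 := chart_img_map ix0.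
have [c c0 cg] := metric_lower_bound g ix0.
pose P x := U x /\ forall v : tangent x, c * `|tcoord i v| <= tnorm g v.
have nP : nbhs x0 P by near=> x; split; near: x.
have : \forall y \near y0, chart_img i y /\ P (chart_inv i y).
  have c1 := chart_inv_cts iy0; have nP' : nbhs (chart_inv i y0) P by rewrite chart_mapK.
  have n1 := near_chart_img iy0; have n2 := c1 _ nP'.
  by near=> y; split; near: y; [exact: n1|exact: n2].
move=> /nbhs_ballP[r /= r0 rP].
have {}rP y : `|y0 - y| < r -> chart_img i y /\ P (chart_inv i y).
  by move=> yr; apply: rP; rewrite -ball_normE.
have WP x : chart_dom i x -> `|y0 - chart_map i x| < r -> P x.
  by move=> ix /rP[_]; rewrite chart_mapK.
pose V x := chart_dom i x /\ `|y0 - chart_map i x| < r / 4.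
exists V.
  near=> x; split; first by near: x; exact: near_chart_dom.
  near: x; apply: (@cvgr_dist_lt _ _ _ (nbhs x0)); last by rewrite divr_gt0.
  exact: chart_map_cts.
exists (c * (r / 4)); first by rewrite mulr_gt0// divr_gt0.
move=> x y [ix xr]; rewrite /riemannian_dist => /ereal_inf_lt[_ [z [pz z0 z1] <-]].
apply: contraPP => nUy; apply/negP; rewrite -leNgt.
have [|||||a /andP[a0 a1] [ar aW]] := @leaves_chart_ball i y0 r z r0.
- by move=> y' /rP[].
- by case: pz.
- by rewrite z0 => -[iy yr]; apply: nUy; have [] := WP _ iy yr.
- by rewrite z1.
- by rewrite z1; apply: lt_trans xr _; lra.
apply: le_trans (curve_length_ge (i := i) (c := c) pz a0 a1 _ (ltW c0) _); last 2 first.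
- by move=> s /aW[].
- by move=> s /aW[iz zr]; have [_] := WP _ iz zr.
rewrite lee_fin ler_wpM2l ?(ltW c0)// z1.
have := ler_distD (chart_map i x) y0 (chart_map i (z a)); lra.
Unshelve. all: by end_near. Qed.

End DistanceTopology.

(** * The Lagrangian near a point *)

Section Fibrewise.
Context {R : realType} {m : nat} {M : smoothManifold R m}.
Local Notation e k := (delta_mx 0 k : 'rV[R]_m.+1).
Implicit Types (F : forall x : M, tangent x -> R) (x : M).

Lemma scalar_differentiable x (f : {scalar tangent x}) v :
  differentiable (f : tangent x -> R^o) v.
Proof.
apply: (@linear_differentiable R (tangent x) R^o f) => w.
have fE u : f u = \sum_k u 0 k * f (e k).
  rewrite {1}(row_sum_delta u) raddf_sum; apply: eq_bigr => k _; exact: linearZ.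
have -> : (f : tangent x -> R^o) = (fun u => \sum_k u 0 k * f (e k)) by apply/funext.
apply: (@cvg_sum _ R^o _ _ (nbhs w)) => k.
by apply: (@cvgM R _ (nbhs w)); [exact: coord_continuous|exact: cvg_cst].
Qed.

Lemma tcoord_differentiable i x (v : tangent x) : chart_dom i x ->
  differentiable (@tcoord R m M i x) v.
Proof.
move=> ix; apply: linear_differentiable.
apply: (iffLR (diff_locallyP _ _) _).1.
by apply: transition_differentiable => //; exact: chart_atP.
Qed.

Lemma local_rep_map F i x w : chart_dom i x ->
  local_rep i F (chart_map i x, w) = F x (tvec i x w).
Proof. by move=> ix; rewrite /local_rep /= chart_mapK. Qed.

Lemma C1_on_TM_differentiable F x (v : tangent x) : C1_on_TM F ->
  differentiable (F x : tangent x -> R^o) v.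
Proof.
move=> FC1; pose i := chart_at x; have ix : chart_dom i x := chart_atP x.
have -> : (F x : tangent x -> R^o) =
    local_rep i F \o (fun u : tangent x => (chart_map i x, tcoord i u)).
  by apply/funext => u; rewrite /= local_rep_map// tcoordK.
apply: differentiable_comp.
  apply: differentiable_pair => //; exact: tcoord_differentiable.
have [+ _] := FC1 i; apply; split => //=; exact: chart_img_map.
Qed.

End Fibrewise.

Lemma is_derive_line (R : realType) (V : normedModType R) (f : V -> R^o) (v w : V) (s : R) :
  differentiable f (v + s *: w) ->
  is_derive s 1 (fun s : R => f (v + s *: w)) ('d f (v + s *: w) w).
Proof.
move=> df; pose a (s : R) := v + s *: w.
have da : is_derive s 1 a w.
  rewrite -[X in is_derive _ _ _ X](add0r w); apply: is_deriveD.
  have ds : differentiable ((fun r : R => r *: w) : R^o -> V) s.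
    by have := is_diff_scalel s w; case.
  apply: DeriveDef; first exact: diff_derivable.
  by rewrite deriveE// diff_val scale1r.
have dda : differentiable a s by apply/derivable1_diffP; exact: ex_derive.
apply: DeriveDef; first by apply/derivable1_diffP; exact: differentiable_comp.
rewrite deriveE; last exact: (@differentiable_comp _ _ _ _ a f).
by rewrite (diff_compE _ erefl dda df) -(deriveE _ dda) derive_val.
Qed.

Lemma scalar_scale (R : realType) (V : lmodType R) (f : {scalar V}) (a : R) (v : V) :
  f (a *: v) = a * f v.
Proof. exact: linearZ. Qed.

Lemma is_derive_quadratic (R : realType) (a b t : R) :
  is_derive t 1 (fun t : R => a * t + b * (t * t)) (a + b * (t + t)).
Proof.
have := is_deriveD (is_deriveZ a (is_derive_id t 1))
  (is_deriveZ b (is_deriveM (is_derive_id t 1) (is_derive_id t 1))).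
by rewrite /GRing.scale/= !mulr1.
Qed.

(** * Growth of the Lagrangian on a single fibre *)

Section NoetherQuadratic.
Context {R : realType} {m : nat} {M : smoothManifold R m}.
Implicit Types (x : M).

Lemma partial_vE (F : forall x : M, tangent x -> R) x (v w : tangent x) :
  differentiable (F x : tangent x -> R^o) v ->
  partial_v F v w = 'd (F x : tangent x -> R^o) v w.
Proof.
move=> dF; have v0 : v + 0 *: w = v by rewrite scale0r addr0.
have := @is_derive_line R _ (F x) v w 0; rewrite v0 => /(_ dF) h.
by rewrite /partial_v derive1E; exact: derive_val.
Qed.

Variable g : riemannian_metric M.

Lemma tnormZ x (c : R) (v : tangent x) : 0 <= c -> tnorm g (c *: v) = c * tnorm g v.
Proof.
move=> c0; rewrite /tnorm.
have -> : g x (c *: v) (c *: v) = c ^+ 2 * g x v v.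
  by rewrite scalar_scale metric_form_sym scalar_scale mulrA expr2.
by rewrite sqrtrM ?sqr_ge0// sqrtr_sqr ger0_norm.
Qed.

Lemma tnorm_ge0 x (v : tangent x) : 0 <= tnorm g v. Proof. exact: sqrtr_ge0. Qed.

Lemma tnorm_eq0 x (v : tangent x) : tnorm g v = 0 -> v = 0.
Proof.
move=> /eqP; rewrite sqrtr_eq0 => gv; apply/eqP; apply: contraT => /(metric_form_pos g).
by rewrite ltNge gv.
Qed.

Lemma covector_norm_le x (l : tangent x -> R) c :
  (forall (a : R) v, l (a *: v) = a * l v) ->
  (covector_norm g l <= c%:E)%E -> forall v, `|l v| <= c * tnorm g v.
Proof.
move=> lZ lc v; have [v0|v0] := eqVneq (tnorm g v) 0.
  by rewrite v0 mulr0 (tnorm_eq0 v0) -[0](scale0r 0) lZ mul0r normr0.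
have n0 : 0 < tnorm g v by rewrite lt_neqAle eq_sym v0 tnorm_ge0.
have : (`|l ((tnorm g v)^-1 *: v)|%:E <= c%:E)%E.
  apply: le_trans lc; apply: ereal_sup_ubound; exists ((tnorm g v)^-1 *: v) => //=.
  by rewrite tnormZ ?mulVf// invr_ge0 ltW.
by rewrite lee_fin lZ normrM (ger0_norm (_ : 0 <= _^-1)) ?invr_ge0 ?(ltW n0)// ler_pdivrMl// mulrC.
Qed.

(* A primitive of the inequality f'(s) - f'(0) >= lam |w|^2 s along the ray s w. *)
Lemma strongly_convex_lower_bound (F : forall x : M, tangent x -> R) x (c lam : R) :
  (forall v, differentiable (F x : tangent x -> R^o) v) ->
  (covector_norm g (partial_v F (0%R : tangent x)) <= c%:E)%E ->
  (forall v1 v2 : tangent x, lam * tnorm g (v2 - v1) ^+ 2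
     <= partial_v F v2 (v2 - v1) - partial_v F v1 (v2 - v1)) ->
  forall w : tangent x, F x 0 - c * tnorm g w + lam / 2 * tnorm g w ^+ 2 <= F x w.
Proof.
have aux1 (k nn a b s : R) : k * nn * s <= a - b -> 0 <= a - (b + k / 2 * nn * (s + s)).
  lra.
have aux2 (F0 F1 k nn b cn : R) : - cn <= b -> F0 - (b * 0 + k / 2 * nn * (0 * 0)) <=
    F1 - (b * 1 + k / 2 * nn * (1 * 1)) -> F0 - cn + k / 2 * nn <= F1 by lra.
move=> dF cF sF w; set n := tnorm g w.
pose D v : tangent x -> R^o := 'd (F x : tangent x -> R^o) v.
have DE v u : partial_v F v u = D v u by exact: partial_vE.
have DZ v (a : R) u : D v (a *: u) = a * D v u by exact: linearZ.
pose p s := D (0 + s *: w) w.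
have p0 : - (c * n) <= p 0.
  have : `|partial_v F (0 : tangent x) w| <= c * n.
    by apply: covector_norm_le cF _ => a v; rewrite !DE DZ.
  by rewrite /p scale0r addr0 DE ler_norml => /andP[].
have ps s : 0 < s -> lam * n ^+ 2 * s <= p s - p 0.
  move=> s0; have h : lam * (s * n) ^+ 2 <= s * p s - s * p 0.
    have H := sF 0 (s *: w).
    rewrite subr0 (DE (s *: w)) (DE 0) !DZ (tnormZ w (ltW s0)) in H.
    by rewrite /p scale0r addr0 add0r.
  move: (p s) (p 0) h => a b h; rewrite -(ler_pM2l s0) mulrBr.
  by have -> : s * (lam * n ^+ 2 * s) = lam * (s * n) ^+ 2 by ring.
pose q (s : R) := F x (0 + s *: w) - (p 0 * s + (lam / 2 * n ^+ 2) * (s * s)).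
have dq (s : R) : is_derive s 1 q (p s - (p 0 + (lam / 2 * n ^+ 2) * (s + s))).
  apply: is_deriveB; [exact: is_derive_line|exact: is_derive_quadratic].
have : q 0 <= q 1.
  apply: (@ger0_derive1_ndecr _ q 0 1) => //.
  - move=> s; rewrite in_itv/= => /andP[s0 s1].
    by rewrite derive1E; have [_ ->] := dq s; apply/aux1/ps.
  - by apply: derivable_within_continuous => s _; have [] := dq s.
by rewrite /q scale0r scale1r addr0 add0r; exact: aux2.
Qed.

Variables (L : forall x : M, tangent x -> R) (K : forall x : M, tangent x)
  (Q : forall x : M, {scalar tangent x}) (d : M -> R).

Lemma lagrangian_along_K x (v : tangent x) (t : R) : C1_on_TM L ->
  (forall v : tangent x, noether L K v = Q x v + d x) ->
  L (v + t *: K x) = L v + t * (Q x v + d x) + Q x (K x) / 2 * t ^+ 2.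
Proof.
move=> LC1 NE; pose q t := L (v + t *: K x) - ((Q x v + d x) * t + Q x (K x) / 2 * (t * t)).
have dq (s : R) : is_derive s (1 : R) q 0.
  have dL := C1_on_TM_differentiable (v + s *: K x) LC1.
  have -> : 0 = 'd (@L x : tangent x -> R^o) (v + s *: K x) (K x)
      - ((Q x v + d x) + Q x (K x) / 2 * (s + s)) :> R.
    rewrite -partial_vE//; have -> : partial_v L (v + s *: K x) (K x) = Q x v + s * Q x (K x) + d x.
      by rewrite -scalar_scale -raddfD -NE.
    by field.
  apply: is_deriveB; [exact: is_derive_line|exact: is_derive_quadratic].
have := is_derive_0_is_cst t 0 dq; rewrite /q scale0r addr0.
move: (L _) (L _) (Q x v + d x) (Q x (K x)) => l1 l2 a b; lra.
Qed.

End NoetherQuadratic.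

(** The condition on [c] says that $ps^2-cst+qt^2$ has nonpositive discriminant; multiplying by $4p$
    completes the square. *)
Lemma young_le (R : realFieldType) (p q c s t : R) : 0 <= s -> 0 <= t -> 0 < p -> 0 <= q ->
  c ^+ 2 <= 4 * p * q -> c * (s * t) <= p * s ^+ 2 + q * t ^+ 2.
Proof.
move=> s0 t0 p0 q0 cpq.
have h : 0 <= (2 * p * s - c * t) ^+ 2 by exact: sqr_ge0.
have t2 : 0 <= (4 * p * q - c ^+ 2) * t ^+ 2 by rewrite mulr_ge0 ?sqr_ge0// subr_ge0.
rewrite -subr_ge0 -(pmulr_rge0 _ (_ : 0 < 4 * p)); last by lra.
by lra.
Qed.

Section CoerciveForm.
Variable R : realFieldType.

(* Completing squares in t = Q(v)/Q(K) and n = |w|, w = v - t K; here B = - Q(K),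
   the value of N is dd - B t, and the linear form takes the value b on w and a on K. *)
Lemma coercive_form (b1 b2 D l1 C1 F0 eps A : R) : 0 < b1 -> b1 <= b2 -> 0 < l1 ->
  0 <= eps -> 0 <= C1 -> 0 <= D -> b2 ^+ 2 * eps ^+ 2 <= b1 * l1 / 16 ->
  exists C : R, forall B dd lam Cx a b n t F Lw : R,
    b1 <= B <= b2 -> `|dd| <= D -> l1 <= lam -> Cx <= C1 -> F0 <= F ->
    b2 + 1 <= a <= A -> 0 <= n -> `|b| <= eps * n ->
    F - Cx * n + lam / 2 * n ^+ 2 <= Lw ->
    (dd - B * t) ^+ 2 + (dd - B * t) * (b + t * a) - C
      <= Lw + t * dd - B / 2 * t ^+ 2.
Proof.
move=> b10 b12 l10 e0 C10 D0 be; pose E := 1 + 2 * b2 + `|A|.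
have E0 : 0 <= E by rewrite /E; have := normr_ge0 A; lra.
(* [F0] bounds the value at the zero vector from below, [D ^+ 2] bounds the square of [dd], and the
   last two terms are the constants left by Young's inequality in [i4] and [i5]. *)
exists (- F0 + D ^+ 2 + 2 * (D * E) ^+ 2 / b1 + 2 * (C1 + D * eps) ^+ 2 / l1).
move=> B dd lam Cx a b n t F Lw /andP[B1 B2] ddD lam1 CxC F0F /andP[a1 a2] n0 bn Lw_ge.
have t0 := normr_ge0 t; have t2 : t ^+ 2 = `|t| ^+ 2 by rewrite real_normK ?num_real.
have i1 : l1 / 2 * n ^+ 2 <= lam / 2 * n ^+ 2 by rewrite ler_wpM2r ?sqr_ge0//; lra.
have i1' : Cx * n <= C1 * n by rewrite ler_wpM2r.
(* The budget: of $b_1t^2/2$, [i3] and [i4] spend $b_1t^2/8$ each; of $l_1n^2/2$, [i3] and [i5]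
   spend $l_1n^2/8$ each. *)
have i2 : b1 / 2 * t ^+ 2 <= (B * a - B / 2 - B ^+ 2) * t ^+ 2.
  by rewrite ler_wpM2r ?sqr_ge0//; nra.
have i3 : - (B * t * b) <= b1 / 8 * `|t| ^+ 2 + l1 / 8 * n ^+ 2.
  apply: (@le_trans _ _ (b2 * eps * (`|t| * n))); last first.
    by apply: young_le => //; rewrite ?exprMn; lra.
  apply: le_trans (ler_norm _) _; rewrite normrN !normrM (ger0_norm (_ : 0 <= B)); last by lra.
  rewrite -mulrA -[b2 * eps * _]mulrA; apply: ler_pM; [by lra|exact: mulr_ge0|by lra|].
  by rewrite mulrCA ler_wpM2l.
have i4 : - (t * dd * (1 + 2 * B - a)) <= b1 / 8 * `|t| ^+ 2 + 2 * (D * E) ^+ 2 / b1.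
  apply: (@le_trans _ _ (D * E * (`|t| * 1))); last first.
    rewrite -[X in _ <= _ + X]mulr1 -[X in _ <= _ + _ * X](expr1n _ 2).
    apply: young_le => //; first by lra.
      by apply: divr_ge0; [apply: mulr_ge0; [exact: ler0n|exact: sqr_ge0]|exact: ltW].
    by rewrite le_eqVlt; apply/orP; left; apply/eqP; field; exact: lt0r_neq0.
  apply: le_trans (ler_norm _) _; rewrite normrN !normrM mulr1 mulrC [`|t| * _]mulrC mulrA.
  rewrite ler_wpM2r// [leRHS]mulrC; apply: ler_pM => //.
  rewrite /E ler_norml; have := ler_norm A; have := normr_ge0 A; lra.
have i5 : C1 * n + dd * b <= l1 / 8 * n ^+ 2 + 2 * (C1 + D * eps) ^+ 2 / l1.
  apply: (@le_trans _ _ ((C1 + D * eps) * (n * 1))); last first.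
    rewrite -[X in _ <= _ + X]mulr1 -[X in _ <= _ + _ * X](expr1n _ 2).
    apply: young_le => //; first by lra.
      by apply: divr_ge0; [apply: mulr_ge0; [exact: ler0n|exact: sqr_ge0]|exact: ltW].
    by rewrite le_eqVlt; apply/orP; left; apply/eqP; field; exact: lt0r_neq0.
  rewrite mulr1 mulrDl lerD2l -mulrA; apply: le_trans (ler_norm _) _.
  by rewrite normrM; apply: ler_pM.
have i6 : dd ^+ 2 <= D ^+ 2 by rewrite -(real_normK (num_real dd)) ler_sqr ?nnegrE.
rewrite t2 in i2.
have l1n : 0 <= l1 * n ^+ 2 by rewrite mulr_ge0 ?sqr_ge0// ltW.
have b1t : 0 <= b1 * `|t| ^+ 2 by rewrite mulr_ge0 ?sqr_ge0// ltW.
move: i2 i3 i4; rewrite -t2 => i2 i3 i4; rewrite -t2 in b1t.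
move: (2 * (D * E) ^+ 2 / b1) (2 * (C1 + D * eps) ^+ 2 / l1) i4 i5 => X Y i4 i5.
lra.
Qed.
End CoerciveForm.

Lemma dot_le (R : realType) (n : nat) (u w : 'rV[R]_n) (c : R) :
  (forall k, `|w 0 k| <= c) -> `|\sum_k u 0 k * w 0 k| <= n%:R * c * `|u|.
Proof.
move=> wc; apply: le_trans (ler_norm_sum _ _ _) _.
apply: (@le_trans _ _ (\sum_(k < n) c * `|u|)); last first.
  by rewrite sumr_const card_ord -[leLHS]mulr_natl mulrA.
apply: ler_sum => k _; rewrite normrM mulrC; apply: ler_pM => //.
exact: coord_le_norm.
Qed.

(** * The lower bound for the Lagrangian near a point *)

Section LocalBound.
Context {R : realType} {m : nat} {M : smoothManifold R m}.
Local Notation e k := (delta_mx 0 k : 'rV[R]_m.+1).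
Variable g : riemannian_metric M.
Variables (L : forall x : M, tangent x -> R) (K : forall x : M, tangent x)
  (Q : forall x : M, {scalar tangent x}) (d : M -> R).

Lemma near_of_chart (i : chart_index M) x0 (f : M -> R) c : chart_dom i x0 ->
  {for chart_map i x0, continuous (f \o chart_inv i : _ -> R^o)} -> 0 < c ->
  \forall x \near x0, `|f x0 - f x| < c.
Proof.
move=> ix cf c0; apply: (near_chart ix).
have E : (f \o chart_inv i) (chart_map i x0) = f x0 by rewrite /= chart_mapK.
by rewrite -E; exact: (@cvgr_dist_lt _ R^o _ _ _ _ _ cf _ c0).
Qed.

Lemma near_of_continuous x0 (f : M -> R) c : continuous f -> 0 < c ->
  \forall x \near x0, `|f x0 - f x| < c.
Proof. by move=> cf c0; exact: (@cvgr_dist_lt _ R^o _ _ _ _ _ (cf x0) _ c0). Qed.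

Lemma one_form_chart_continuous (i : chart_index M) x0 k : chart_dom i x0 -> C1_one_form Q ->
  {for chart_map i x0, continuous
    ((fun x => Q x (tvec i x (e k))) \o chart_inv i : _ -> R^o)}.
Proof.
move=> ix QC1; have [+ _] := QC1 i (e k).
by move=> /(_ _ (chart_img_map ix)); exact: differentiable_continuous.
Qed.

Lemma vector_field_chart_continuous (i : chart_index M) x0 k : chart_dom i x0 ->
  C1_vector_field K ->
  {for chart_map i x0, continuous
    ((fun x => tcoord i (K x) 0 k) \o chart_inv i : _ -> R^o)}.
Proof.
move=> ix KC1; have [+ _] := KC1 i.
move=> /(_ _ (chart_img_map ix))/differentiable_continuous c.
exact: (@continuous_comp _ _ _ _ _ _ c (@coord_continuous _ _ _ 0 k _)).
Qed.

Lemma lagrangian_zero_chart_continuous (i : chart_index M) x0 : chart_dom i x0 -> C1_on_TM L ->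
  {for chart_map i x0, continuous ((fun x => L (0 : tangent x)) \o chart_inv i : _ -> R^o)}.
Proof.
move=> ix LC1; have [+ _] := LC1 i.
move=> /(_ (chart_map i x0, 0))/(_ _)/differentiable_continuous => H.
have -> : ((fun x => L (0 : tangent x)) \o chart_inv i : _ -> R^o) =
    local_rep i L \o (fun y => (y, 0)).
  apply/funext => y; rewrite /local_rep /= (_ : tvec i _ 0 = 0)//; exact: raddf0.
apply: continuous_comp; last by apply: H; split => //; exact: chart_img_map.
by apply: differentiable_continuous; exact: differentiable_pair.
Qed.

(** In the chart $Q(K)$ is the sum of products of components, but only on the image of the chart, so
    continuity is transferred through an equality near the point. *)
Lemma pairing_chart_continuous (i : chart_index M) x0 : chart_dom i x0 ->
  C1_one_form Q -> C1_vector_field K ->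
  {for chart_map i x0, continuous ((fun x => Q x (K x)) \o chart_inv i : _ -> R^o)}.
Proof.
move=> ix QC1 KC1.
pose f y := \sum_k tcoord i (K (chart_inv i y)) 0 k
  * Q (chart_inv i y) (tvec i (chart_inv i y) (e k)).
pose q : 'rV[R]_m.+1 -> R^o := (fun x => Q x (K x)) \o chart_inv i.
have qE y : chart_img i y -> q y = f y.
  by move=> iy; rewrite /f -scalar_tvec tcoordK//; exact: chart_inv_dom.
have cf : f y @[y --> chart_map i x0] --> f (chart_map i x0).
  apply: (@cvg_sum _ R^o _ _ (nbhs (chart_map i x0))) => k.
  apply: (@cvgM R _ (nbhs (chart_map i x0))).
    exact: (@vector_field_chart_continuous i x0 k ix KC1).
  exact: (@one_form_chart_continuous i x0 k ix QC1).
suff : q y @[y --> chart_map i x0] --> q (chart_map i x0) by [].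
rewrite (qE _ (chart_img_map ix)).
have nE : \forall y \near chart_map i x0, f y = q y.
  have := near_chart_img (chart_img_map ix); apply: filterS => y /qE; exact: esym.
apply: cvg_trans cf.
exact: (@near_eq_cvg _ _ _ (@nbhs_filter _ (chart_map i x0)) _ _ nE).
Qed.

Lemma lagrangian_local_bound (x0 : M) : condition_S L K Q d -> condition_G g L K Q ->
  exists (l : 'rV[R]_m.+1) (C : R), \forall x \near x0, forall v : tangent x,
    noether L K v ^+ 2
      + noether L K v * (\sum_k tcoord (chart_at x0) v 0 k * l 0 k) - C <= L v.
Proof.
move=> [LC1 KC1 _ [QC1 dC1 NE] [_ QK]].
move=> [Cf [lam [[cC clam Clam_pos] [_ _ vG convG]]]].
pose i := chart_at x0; have ix : chart_dom i x0 := chart_atP x0.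
have [c c0 cg] := metric_lower_bound g ix.
pose b0 := - Q x0 (K x0); have b00 : 0 < b0 by rewrite oppr_gt0.
pose qx (k : 'I_m.+1) := Q x0 (tvec i x0 (e k)).
(* Chosen so that [l] takes the value [al], which is [b2 + 2], on $K_{x_0}$; the sign compensates
   $Q_{x_0}(K_{x_0})<0$. Near [x0] the value on $K_x$ then stays between [b2 + 1] and [b2 + 3]. *)
pose al := 2 * b0 + 2; pose sc := - (al / b0).
pose l : 'rV[R]_m.+1 := \row_k (sc * qx k).
have [C0 lam0] := Clam_pos x0.
pose l1 := lam x0 / 2; pose b1 := b0 / 2; pose b2 := 2 * b0.
have l10 : 0 < l1 by rewrite divr_gt0.
have b10 : 0 < b1 by rewrite divr_gt0.
(* The cap at $1$ gives [eps ^+ 2 <= eps], so a bound linear in [eps] yields the quadratic one. *)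
pose eps := Num.min 1 (b1 * l1 / 16 / b2 ^+ 2).
have b20 : 0 < b2 by rewrite mulr_gt0.
have eps0 : 0 < eps by rewrite lt_min ltr01 /= !(divr_gt0, mulr_gt0, exprn_gt0).
have eps_small : b2 ^+ 2 * eps ^+ 2 <= b1 * l1 / 16.
  have eps1 : eps <= 1 by rewrite ge_min lexx.
  rewrite mulrC -ler_pdivlMr ?exprn_gt0//.
  apply: (@le_trans _ _ eps); last by rewrite ge_min lexx orbT.
  by rewrite expr2 ler_piMl// ltW.
have N0 : 0 < (m.+1%:R : R) by rewrite ltr0n.
have sc1 : 0 < `|sc| + 1 by rewrite ltr_wpDl.
(* The tolerance on each coefficient of $Q$ that gives $|l(w)|\le\varepsilon\|w\|$ on $\ker Q_x$:
   there are [m.+1] coefficients scaled by [sc], and [c] compares the chart norm with that of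
   $g$. *)
pose eta := eps * c / (m.+1%:R * (`|sc| + 1)).
have eta0 : 0 < eta by rewrite divr_gt0 ?mulr_gt0.
have eta_small : m.+1%:R * (`|sc| * eta) <= eps * c.
  have <- : eta * (m.+1%:R * (`|sc| + 1)) = eps * c.
    by rewrite divfK// gt_eqF// mulr_gt0.
  rewrite [eta * _]mulrC -[leRHS]mulrA ler_pM2l// ler_pM2r//; lra.
have [|||C HC] := @coercive_form R b1 b2 (`|d x0| + 1) l1 (Cf x0 + 1) (L (0 : tangent x0) - 1)
  eps (b2 + 3) b10 _ l10 (ltW eps0) _ _ eps_small.
- by rewrite /b1 /b2; lra.
- by rewrite addr_ge0// ltW.
- by rewrite addr_ge0.
exists l, C.
pose a x := \sum_k tcoord i (K x) 0 k * l 0 k.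
have a_x0 : a x0 = al.
  rewrite /a; under eq_bigr do rewrite mxE mulrCA.
  rewrite -mulr_sumr -scalar_tvec tcoordK// /sc -[Q x0 (K x0)]opprK -/b0.
  by rewrite mulrNN divfK// gt_eqF.
have ca : {for chart_map i x0, continuous (a \o chart_inv i : _ -> R^o)}.
  apply: (@cvg_sum _ R^o _ _ (nbhs (chart_map i x0))) => k.
  apply: (@cvgM R _ (nbhs (chart_map i x0))); last exact: cvg_cst.
  exact: (@vector_field_chart_continuous i x0 k ix KC1).
have n1 := near_of_chart ix (pairing_chart_continuous ix QC1 KC1) (divr_gt0 b00 (ltr0n _ 2)).
have n2 : \forall x \near x0, `|d x0 - d x| < 1.
  apply: (near_of_chart ix _ ltr01); have [+ _] := dC1 i.
  by move=> /(_ _ (chart_img_map ix))/differentiable_continuous.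
have n3 := near_of_continuous x0 clam l10.
have n4 := near_of_continuous x0 cC (ltr01 : 0 < 1 :> R).
have n5 := near_of_chart ix (lagrangian_zero_chart_continuous ix LC1) ltr01.
have n6 : \forall x \near x0, forall k : 'I_m.+1, `|qx k - Q x (tvec i x (e k))| < eta.
  apply: (filter_forall (@nbhs_filter _ x0) _) => k.
  have H := near_of_chart ix (@one_form_chart_continuous i x0 k ix QC1) eta0.
  exact: H.
have n7 := near_of_chart ix ca ltr01.
have n8 := near_chart_dom ix.
near=> x => v.
have ix' : chart_dom i x by near: x; exact: n8.
have x1 : `|Q x0 (K x0) - Q x (K x)| < b0 / 2 by near: x; exact: n1.
have x2 : `|d x0 - d x| < 1 by near: x; exact: n2.
have x3 : `|lam x0 - lam x| < l1 by near: x; exact: n3.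
have x4 : `|Cf x0 - Cf x| < 1 by near: x; exact: n4.
have x5 : `|L (0 : tangent x0) - L (0 : tangent x)| < 1 by near: x; exact: n5.
have x6 : forall k : 'I_m.+1, `|qx k - Q x (tvec i x (e k))| < eta by near: x; exact: n6.
have x7 : `|a x0 - a x| < 1 by near: x; exact: n7.
have x8 : forall u : tangent x, c * `|tcoord i u| <= tnorm g u by near: x; exact: cg.
have QKx := QK x; pose t := Q x v / Q x (K x); pose w := v - t *: K x.
have vE : v = w + t *: K x by rewrite subrK.
have Qv : Q x v = Q x w + t * Q x (K x) by rewrite -scalar_scale -raddfD -vE.
have Qw : Q x w = 0.
  by apply: (addIr (t * Q x (K x))); rewrite -Qv add0r divfK// lt_eqF.
have LcE (u : tangent x) : Q x u = 0 -> Lc L K Q u = L u.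
  by move=> Qu; rewrite /Lc Qu expr0n mul0r subr0.
have dLc (u : tangent x) : differentiable (@Lc _ _ _ L K Q x : tangent x -> R^o) u.
  have dL := C1_on_TM_differentiable u LC1.
  have dQ := scalar_differentiable (Q x) u.
  have -> : (@Lc _ _ _ L K Q x : tangent x -> R^o)
      = (@L x : tangent x -> R^o) - (Q x : tangent x -> R^o) * Q x * cst (Q x (K x))^-1.
    by apply/funext => y; rewrite /Lc expr2.
  apply: differentiableB => //; apply: differentiableM => //; exact: differentiableM.
have cLc : (covector_norm g (partial_v (Lc L K Q) (0%R : tangent x)) <= (Cf x)%:E)%E.
  by have := vG x 0; rewrite /tnorm raddf0 sqrtr0 add0r mulr1.
have := strongly_convex_lower_bound dLc cLc (convG x) w.
rewrite LcE ?raddf0// LcE// => Lw.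
have Lv := lagrangian_along_K (d := d) w t LC1 (NE x).
rewrite -vE Qw add0r in Lv.
have Nv : noether L K v = d x - (- Q x (K x)) * t.
  by rewrite NE Qv Qw; ring.
have tv : \sum_k tcoord i v 0 k * l 0 k
    = (\sum_k tcoord i w 0 k * l 0 k) + t * a x.
  rewrite {1}vE tcoordD tcoordZ /a mulr_sumr -big_split /=; apply: eq_bigr => k _.
  by rewrite !mxE; ring.
have alg (u1 u2 u3 u4 : R) : u1 * (u2 * u3) - u1 * (u2 * (u3 - u4)) = u2 * (u1 * u4) by ring.
have bw : `|\sum_k tcoord i w 0 k * l 0 k| <= eps * tnorm g w.
  (* Since $Q_x(w)=0$, subtracting the same multiple of $Q_x$ from [l] changes nothing, and only the
     small coefficients of $Q_{x_0}-Q_x$ remain. *)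
  have -> : \sum_k tcoord i w 0 k * l 0 k
      = \sum_k tcoord i w 0 k * (\row_k (sc * (qx k - Q x (tvec i x (e k))))) 0 k.
    apply/eqP; rewrite -subr_eq0 -sumrB; apply/eqP.
    transitivity (sc * Q x (tvec i x (tcoord i w))); last by rewrite tcoordK// Qw mulr0.
    rewrite scalar_tvec mulr_sumr; apply: eq_bigr => k _; rewrite [l 0 k]mxE [(\row__ _) 0 k]mxE.
    exact: alg.
  apply: le_trans (dot_le _ (c := `|sc| * eta) _) _.
    by move=> k; rewrite mxE normrM ler_wpM2l// ltW.
  apply: (@le_trans _ _ (eps * c * `|tcoord i w|)); first by rewrite ler_wpM2r.
  by rewrite -mulrA ler_wpM2l// ltW.
have alg2 (u1 u2 u3 : R) : u1 + u2 / 2 * u3 = u1 - - u2 / 2 * u3 by rewrite !mulNr opprK.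
rewrite Nv tv Lv alg2; apply: (HC _ _ (lam x) (Cf x) _ _ (tnorm g w) _ (L (0 : tangent x))) => //.
- move: x1; rewrite /b1 /b2 /b0 ltr_norml => /andP[h1 h2].
  by clear -h1 h2; lra.
- have h1 := ler_normD (d x0) (d x - d x0); rewrite addrC subrK distrC in h1.
  by clear -h1 x2; lra.
- move: x3; rewrite /l1 ltr_norml => /andP[h1 h2].
  by clear -h1 h2; lra.
- move: x4; rewrite ltr_norml => /andP[h1 h2].
  by clear -h1 h2; lra.
- move: x5; rewrite ltr_norml => /andP[h1 h2].
  by clear -h1 h2; lra.
- move: x7; rewrite a_x0 /al /b2 ltr_norml => /andP[h1 h2].
  by clear -h1 h2; lra.
- exact: tnorm_ge0.
Unshelve. all: by end_near. Qed.

End LocalBound.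

(** * Lower bounds for the action *)

(** Compactness of $[0,1]$ as a supremum argument: the times reachable from $0$ extend past their
    supremum unless it is $1$. *)
Lemma interval_induction (R : realType) (P : R -> R -> Prop) :
  (forall s, 0 <= s <= 1 -> exists2 d, 0 < d & forall a b,
     0 <= a -> a <= b -> b <= 1 -> `|a - s| < d -> `|b - s| < d -> P a b) ->
  (forall a b c, a <= b -> b <= c -> P a b -> P b c -> P a c) -> P 0 1.
Proof.
move=> Ploc Pcat; pose S := [set t | 0 <= t <= 1 /\ P 0 t].
have S0 : S 0.
  split; first by rewrite lexx ler01.
  by have [|d d0] := Ploc 0; [rewrite lexx ler01|apply; rewrite ?subrr ?normr0 ?ler01].
have Sub : has_ubound S by exists 1 => s [/andP[]].
have hS : has_sup S by split => //; exists 0.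
have tau0 : 0 <= sup S by exact: ub_le_sup.
have tau1 : sup S <= 1 by apply: ge_sup; [exists 0|move=> s [/andP[]]].
have [|d d0 Pd] := Ploc (sup S); first by rewrite tau0.
have [t St td] := sup_adherent d0 hS; have [/andP[t0 t1] P0t] := St.
have tsup := ub_le_sup Sub St.
pose r := Num.min 1 (sup S + d / 2).
have [supr rd r1] : [/\ sup S <= r, r - sup S < d & r <= 1].
  by rewrite /r; case: (leP 1 (sup S + d / 2)) => ?; split; lra.
have P0r : P 0 r.
  apply: (Pcat _ t) => //; first exact: le_trans supr.
  by apply: Pd => //; [exact: le_trans supr|rewrite ler0_norm; lra|rewrite ger0_norm; lra].
have Sr : S r by split => //; rewrite r1 (le_trans tau0).
have := ub_le_sup Sub Sr; move: Sr P0r; rewrite /r.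
by case: (leP 1 (sup S + d / 2)) => // _ _ _; lra.
Qed.

Lemma ae_neq (R : realType) (b : R) : {ae (@lebesgue_measure R), forall s, s != b}.
Proof.
exists [set b]; split; [exact: measurable_set1|exact: lebesgue_measure_set1|].
by move=> s /= /negP; rewrite negbK => /eqP.
Qed.

Section ActionLowerBound.
Context {R : realType} {m : nat} {M : smoothManifold R m}.
Variable L : forall x : M, tangent x -> R.
Local Notation mu := (@lebesgue_measure R).
Implicit Types (w : R -> M) (a b r : R).

(* L along w need not be measurable, so the action is bounded through an integrable
   minorant instead of being split over subintervals. *)
Definition action_ge w a b r := exists G : R -> R,
  [/\ mu.-integrable setT (EFin \o G), forall s, ~ (a < s < b) -> G s = 0,
      {ae mu, forall s, a < s < b -> G s <= L (velocity w s)} &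
      (r%:E <= \int[mu]_s (G s)%:E)%E].

(** Each minorant vanishes off its own interval, so their sum is a minorant except possibly at the
    common endpoint. *)
Lemma action_ge_cat w a b c r1 r2 : a <= b -> b <= c ->
  action_ge w a b r1 -> action_ge w b c r2 -> action_ge w a c (r1 + r2).
Proof.
move=> ab bc [G1 [i1 z1 l1 I1]] [G2 [i2 z2 l2 I2]]; exists (G1 \+ G2); split.
- rewrite (_ : _ \o _ = (EFin \o G1) \+ (EFin \o G2))%E; first exact: integrableD.
  by apply/funext => s /=; rewrite EFinD.
- by move=> s nac /=; rewrite z1 ?z2 ?addr0// => h; apply: nac; lra.
- have l3 := ae_neq b; move: l1 l2 l3.
  apply: (@filterS3 _ _ (ae_filter_ringOfSetsType mu)) => s h1 h2 sb /andP[as_ sc] /=.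
  have [sb'|bs|sE] := ltgtP s b; last by rewrite sE eqxx in sb.
    by rewrite z2 ?addr0; [apply: h1; rewrite as_|lra].
  by rewrite z1 ?add0r; [apply: h2; rewrite bs|lra].
- under eq_integral do rewrite EFinD.
  by rewrite integralD//= EFinD leeD.
Qed.

Lemma action_ge_action w r : action_ge w 0 1 r -> (r%:E <= action L w)%E.
Proof.
move=> [G [iG zG lG IG]]; apply: (le_trans IG).
have m01 : measurable (`[0, 1] : set (measurableTypeR R)) by exact: measurable_itv.
have -> : (\int[mu]_s (G s)%:E = \int[mu]_(s in `[0%R, 1%R]) (G s)%:E)%E.
  rewrite [RHS]integral_mkcond; apply: eq_integral => s _; rewrite patchE.
  case: ifPn => // /negP s01; rewrite zG// => s01'; apply: s01.
  by rewrite inE/= in_itv/=; lra.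
have l0 := @ae_neq R 0; have l1 := @ae_neq R 1.
apply: ae_le_integral => //; move: lG l0 l1.
apply: (@filterS3 _ _ (ae_filter_ringOfSetsType mu)) => s h s0 s1.
rewrite /= in_itv/= lee_fin => /andP[s0' s1'].
have s01 : 0 < s < 1 by rewrite !lt_neqAle s0' s1' s1 eq_sym s0.
exact: h s01.
Qed.

Variables (K : forall x : M, tangent x).

Lemma action_ge_chart (i : chart_index M) w a b k (l : 'rV[R]_m.+1) C D :
  0 <= a -> a <= b -> b <= 1 -> 0 <= D -> AC_curve w -> noether_const L K w k ->
  (forall s, a <= s <= b -> chart_dom i (w s)) ->
  (forall s, a <= s <= b -> forall v : tangent (w s),
     noether L K v ^+ 2 + noether L K v * (\sum_j tcoord i v 0 j * l 0 j) - C <= L v) ->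
  `|chart_map i (w b) - chart_map i (w a)| <= D ->
  action_ge w a b ((b - a) * k ^+ 2 - (m.+1%:R * `|l| * D + `|C|) * (`|k| + 1)).
Proof.
move=> a0 ab b1 D0 [cw acw] wk iw wL wD.
have B0 : 0 <= m.+1%:R * `|l| * D + `|C| by rewrite addr_ge0// !mulr_ge0.
(* The degenerate interval, which occurs in [interval_induction], is treated apart: [curve_FTC]
   requires [a < b]. *)
move: ab; rewrite le_eqVlt => /predU1P[ab|ab].
  exists (cst 0); split => //.
  - exact: integrable0.
  - by apply: aeW => s; rewrite ab; lra.
  - rewrite integral0 lee_fin ab subrr mul0r sub0r oppr_le0 mulr_ge0// addr_ge0//.
have cwab : {within `[a, b], continuous w}.
  by apply: continuous_subspaceW cw => s /=; rewrite !in_itv/=; lra.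
have [f [fi fv fI]] := curve_FTC ab cwab iw (acw i a b a0 (ltW ab) b1 iw).
pose c0 := k ^+ 2 - C; pose kl j := k * l 0 j.
(* The lower bound [wL] with the charge frozen at [k] and the velocity replaced by its integrable
   representative [f]. *)
pose h s := c0 + \sum_j kl j * f s 0 j.
have mab : measurable (`[a, b] : set (measurableTypeR R)) by exact: measurable_itv.
have hE : EFin \o h
    = ((EFin \o cst c0) \+ (fun s => \sum_j (kl j)%:E * (f s 0 j)%:E))%E.
  by apply/funext => s /=; rewrite /h EFinD -sumEFin; under eq_bigr do rewrite EFinM.
have ci : mu.-integrable `[a, b] (EFin \o cst c0).
  apply: continuous_compact_integrable; first exact: segment_compact.
  by apply: continuous_subspaceT => s; exact: cvg_cst.
have fij j : mu.-integrable `[a, b] (fun s => (kl j)%:E * (f s 0 j)%:E)%E.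
  by apply: integrableZl => //; apply: integrableS (fi j).
have si : mu.-integrable `[a, b] (fun s => \sum_j (kl j)%:E * (f s 0 j)%:E)%E.
  by apply: integrable_sum.
have hi : mu.-integrable `[a, b] (EFin \o h) by rewrite hE; exact: integrableD.
pose u : 'rV[R]_m.+1 := chart_map i (w b) - chart_map i (w a).
have hI : (\int[mu]_(s in `[a, b]) (h s)%:E
    = (c0 * (b - a) + k * \sum_j u 0 j * l 0 j)%:E)%E.
  transitivity (\int[mu]_(s in `[a, b]) (EFin \o h) s)%E; first by [].
  rewrite hE integralD// EFinD; congr (_ + _)%E.
    transitivity (\int[mu]_(s in `[a, b]) (cst c0%:E) s)%E; first by [].
    by rewrite integral_cst//= lebesgue_measure_itv/= lte_fin ab -EFinD -EFinM.
  rewrite integral_sum//.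
  rewrite mulr_sumr -sumEFin; apply: eq_bigr => j _.
  rewrite integralZl//; last by apply: integrableS (fi j).
  by rewrite fI -EFinM /u /kl !mxE; congr EFin; ring.
have mo : measurable (`]a, b[ : set (measurableTypeR R)) by exact: measurable_itv.
exists (h \_ `]a, b[); split.
- rewrite -restrict_EFin; apply/(integrable_mkcond _ mo).1.
  by apply: integrableS hi => //; exact: subset_itv_oo_cc.
- by move=> s nab; rewrite patchE memNset//= in_itv.
- move: fv wk; apply: (@filterS2 _ _ (ae_filter_ringOfSetsType mu)) => s fs ns sab.
  rewrite patchE mem_set/=; last by rewrite in_itv.
  have sab' : a <= s <= b by lra.
  have ks : noether L K (velocity w s) = k by apply: ns; lra.
  apply: le_trans (wL s sab' (velocity w s)); rewrite ks (fs sab) /h /c0 mulr_sumr.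
  rewrite addrAC lerD2r lerD2l; apply: ler_sum => j _.
  by rewrite le_eqVlt; apply/orP; left; apply/eqP; rewrite /kl; ring.
- have -> : (\int[mu]_s ((h \_ `]a, b[) s)%:E = \int[mu]_(s in `]a, b[) (h s)%:E)%E.
    rewrite [RHS]integral_mkcond; apply: eq_integral => s _.
    by rewrite !patchE; case: ifP.
  rewrite -(@integral_itv_bndoo _ _ _ _ true false); last first.
    by case/integrableP : hi => + _; apply: measurable_funS => //; exact: subset_itv_oo_cc.
  rewrite [leRHS]hI lee_fin.
  have swap : \sum_j u 0 j * l 0 j = \sum_j l 0 j * u 0 j by apply: eq_bigr => j _; rewrite mulrC.
  have sle := dot_le l (w := u) (c := D) (fun j => le_trans (coord_le_norm u j) wD).
  have h1 : - (m.+1%:R * `|l| * D * `|k|) <= k * \sum_j u 0 j * l 0 j.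
    rewrite lerNl; apply: le_trans (ler_norm _) _; rewrite normrN normrM swap mulrC.
    by rewrite ler_wpM2r// mulrAC.
  have h2 : - `|C| <= - (C * (b - a)).
    rewrite lerN2; apply: le_trans (ler_norm _) _; rewrite normrM ler_piMr//.
    by rewrite ger0_norm; lra.
  have h3 : 0 <= m.+1%:R * `|l| * D by rewrite !mulr_ge0.
  have h4 : 0 <= `|C| * `|k| by rewrite mulr_ge0.
  move: h1 h2 h3 h4; rewrite /c0.
  move: (m.+1%:R * `|l| * D) (k * \sum_j _) (`|C|) (`|k|) => X Y Z W h1 h2 h3 h4.
  clear -h1 h2 h3 h4; lra.
Qed.

End ActionLowerBound.

(** * From local bounds to coercivity along a continuous curve *)

Section Localisation.
Context {R : realType} {m : nat} {M : smoothManifold R m}.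
Variable g : riemannian_metric M.
Variables (L : forall x : M, tangent x -> R) (K : forall x : M, tangent x)
  (Q : forall x : M, {scalar tangent x}) (d : M -> R).

(** [e] and [B] come before [w] and [k]: this uniformity is what concatenation preserves and what
    the final argument uses. *)
Definition action_ge_near (z : R -> M) (a b : R) := exists e B : R, [/\ 0 < e, 0 <= B &
  forall w k, AC_curve w -> noether_const L K w k ->
    (forall s, 0 <= s <= 1 -> (riemannian_dist g (w s) (z s) < e%:E)%E) ->
    action_ge L w a b ((b - a) * k ^+ 2 - B * (`|k| + 1))].

Lemma action_ge_near_cat z a b c : a <= b -> b <= c ->
  action_ge_near z a b -> action_ge_near z b c -> action_ge_near z a c.
Proof.
move=> ab bc [e1 [B1 [e10 B10 H1]]] [e2 [B2 [e20 B20 H2]]].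
exists (Num.min e1 e2), (B1 + B2); split; [by rewrite lt_min e10|exact: addr_ge0|].
move=> w k acw wk wz.
have -> : (c - a) * k ^+ 2 - (B1 + B2) * (`|k| + 1)
    = ((b - a) * k ^+ 2 - B1 * (`|k| + 1)) + ((c - b) * k ^+ 2 - B2 * (`|k| + 1)) by ring.
apply: action_ge_cat ab bc (H1 w k acw wk _) (H2 w k acw wk _) => s s01.
- by apply: lt_le_trans (wz s s01) _; rewrite lee_fin ge_min lexx.
- by apply: lt_le_trans (wz s s01) _; rewrite lee_fin ge_min lexx orbT.
Qed.

Lemma action_ge_near_local (z : R -> M) (s0 : R) : condition_S L K Q d -> condition_G g L K Q ->
  {within `[0, 1], continuous z} -> 0 <= s0 <= 1 ->
  exists2 r, 0 < r & forall a b, 0 <= a -> a <= b -> b <= 1 ->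
    `|a - s0| < r -> `|b - s0| < r -> action_ge_near z a b.
Proof.
move=> hS hG cz s01; have [l [C lC]] := lagrangian_local_bound (z s0) hS hG.
pose i := chart_at (z s0); have iz : chart_dom i (z s0) := chart_atP _.
pose U x := [/\ forall v : tangent x, noether L K v ^+ 2
      + noether L K v * (\sum_k tcoord i v 0 k * l 0 k) - C <= L v,
  chart_dom i x & `|chart_map i (z s0) - chart_map i x| < 1].
have nU : nbhs (z s0) U.
  have n2 := near_chart_dom iz.
  have n3 := @cvgr_dist_lt _ _ _ _ _ _ _ (chart_map_cts iz) _ (ltr01 : 0 < 1 :> R).
  by near=> x; split; near: x; [exact: lC|exact: n2|exact: n3].
have [V nV [e e0 VU]] := dist_nbhs g nU.
have [r r0 zV] := within_itv_near cz s01 nV.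
(* The factor $2$ bounds the displacement in the chart, both ends lying within $1$ of the image of
   [z s0]. *)
exists r => // a b a0 ab b1 ar br; exists e, (m.+1%:R * `|l| * 2 + `|C|).
split; [exact: e0|by rewrite addr_ge0// !mulr_ge0|].
move=> w k acw wk wz.
have wU s : a <= s <= b -> U (w s).
  move=> /andP[as_ sb]; have s01' : 0 <= s <= 1 by lra.
  apply: VU (wz s s01'); apply: zV => //.
  by move: ar br; rewrite !ltr_norml => /andP[? ?] /andP[? ?]; apply/andP; split; lra.
apply: (@action_ge_chart _ _ _ L K i) => //.
- by move=> s /wU[].
- by move=> s /wU[].
- have [_ _ wa] : U (w a) by apply: wU; rewrite lexx.
  have [_ _ wb] : U (w b) by apply: wU; rewrite lexx ab.
  have := ler_distD (chart_map i (z s0)) (chart_map i (w b)) (chart_map i (w a)).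
  by rewrite [`|chart_map i (w b) - chart_map i (z s0)|]distrC; lra.
Unshelve. all: by end_near. Qed.

Lemma action_coercive (z : R -> M) : condition_S L K Q d -> condition_G g L K Q ->
  {within `[0, 1], continuous z} -> exists e B : R, [/\ 0 < e, 0 <= B &
  forall w k, AC_curve w -> noether_const L K w k ->
    (forall s, 0 <= s <= 1 -> (riemannian_dist g (w s) (z s) < e%:E)%E) ->
    ((k ^+ 2 - B * (`|k| + 1))%:E <= action L w)%E].
Proof.
move=> hS hG cz; have [|a b c ab bc|e [B [e0 B0 H]]] := @interval_induction R (action_ge_near z).
- by move=> s s01; exact: action_ge_near_local hS hG cz s01.
- exact: action_ge_near_cat.
exists e, B; split => // w k acw wk wz.
by have := action_ge_action (H w k acw wk wz); rewrite subr0 mul1r.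
Qed.

End Localisation.

Theorem theorem7p6 (R : realType) (m : nat) (hm : (1 <= m)%N)
    (M : smoothManifold R m) (connM : connected [set: M]%classic)
    (g : riemannian_metric M) (complete_g : complete_metric g)
    (L : forall x : M, tangent x -> R)
    (K : forall x : M, tangent x)
    (Q : forall x : M, {scalar tangent x})
    (d : M -> R)
    (hS : condition_S L K Q d) (hG : condition_G g L K Q)
    (p q : M) (c : R) (hJ : (Jsub g L K p q c !=set0)%classic) :
  c_precompact g L K p q c -> c_bounded g L K p q c.
Proof.
move=> pre; split => //; rewrite ltey; apply/eqP => supy.
have big n : exists zk : (R -> M) * R,
    [/\ Jsub g L K p q c zk.1, noether_const L K zk.1 zk.2 & n%:R < `|zk.2|].
  have : (n%:R%:E < ereal_sup [set (`|k|)%:E | k in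
      [set k | exists2 z, Jsub g L K p q c z & noether_const L K z k]])%E by rewrite supy ltry.
  by move=> /ereal_sup_gt[_ [k [z Jz zk] <-]]; rewrite lte_fin => nk; exists (z, k).
have {big}/choice[u uP] := big.
have [|sg [z [sgm cz uz]]] := pre (fun n => (u n).1); first by move=> n; have [] := uP n.
have [e [B [e0 B0 H]]] := action_coercive hS hG cz.
have [N HN] := uz e e0.
have sg_ge n : (n <= sg n)%N.
  by elim: n => // n IH; apply: leq_ltn_trans IH (sgm _ _ (ltnSn n)).
(* For $k>B+|c|+1$ one has $k^2-Bk-B\ge k(|c|+1)-B\ge k-B>|c|$, so the action exceeds $c$. *)
pose n := maxn N (Num.bound (B + `|c| + 1)).
have [Jz zk ksg] := uP (sg n); have [[[acz _ _ _] _] Ac] := Jz.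
have := le_trans (H _ _ acz zk (HN n (leq_maxl _ _))) Ac.
rewrite lee_fin; apply/negP; rewrite -ltNge.
have kbig : B + `|c| + 1 < `|(u (sg n)).2|.
  apply: lt_le_trans (ltW ksg); apply: lt_le_trans (archi_boundP _) _.
    by rewrite !addr_ge0.
  by rewrite ler_nat (leq_trans _ (sg_ge n))// leq_maxr.
rewrite -(real_normK (num_real (u (sg n)).2)).
move: (`|(u (sg n)).2|) (ler_norm c) (normr_ge0 c) kbig => k cle c0 kbig.
clear -B0 cle c0 kbig; nra.
Qed.
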